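(* Consider the sparse PCA setting described in the context, and suppose that as $n\to\infty$: (1) $s\log(p)\ll n$, $k\ll s$, and $n\lesssim p$; (2) (sparsistency) the support $\hat J$ selected by the sparse PCA algorithm satisfies $\mathbb{P}(\hat J=J)\ge 1-\delta$; (3) $X_i=\Sigma^{1/2}Y_i$, where $Y_1,\dots,Y_n\in\mathbb{R}^p$ are independent, mean zero, with independent coordinates of unit variance, and $\|Y_{ij}\|_{\psi_2}\le B$ for all $i,j$ and an absolute constant $B$; (4) $C\lambda_1\Big(\sqrt{\tfrac{s}{n}}+\sqrt{\tfrac{\log(p)}{n}}\Big)+\tfrac{\lambda_{k+1}}{8}\le\tfrac{\lambda_k}{8}$ for some sufficiently large constant $C$, and for all $p$, $2\lambda_{k+1}<(1-\varepsilon)\lambda_k$ for some constant $\varepsilon>\tfrac1{64}$. Let $\kappa=\lambda_1/\lambda_k$ and let $\tilde U\in\mathbb{R}^{p\times k}$ be the output of the refitting procedure described in the context. Then with probability at least $1-\delta-p^{-2}$ there exists an orthogonal matrix $W_*\in\mathbb{O}(k)$ such that $$\max_{1\le i\le p}\|\tilde U_{i\cdot}-(UW_* )_{i\cdot}\|\lesssim \mathcal{E}_1+\mathcal{E}_2+\mathcal{E}_3+\mathcal{E}_4+\mathcal{E}_5,$$ where $$\mathcal{E}_1=\frac{\kappa\lambda_1}{\lambda_k-\lambda_{k+1}}\frac{s\log(p)}{n}\|U\|_{2\to\infty}+\kappa k\sqrt{\frac{\log(p)}{n}}\,\|U\|_{2\to\infty},$$ $$\mathcal{E}_2=\frac{\lambda_1^2}{(\lambda_k-\lambda_{k+1})^2}\frac{s\log(p)}{n}\|U\|_{2\to\infty},$$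 $$\mathcal{E}_3=\sqrt{\frac{s\log(p)}{n}}\,\frac{\kappa\lambda_1^{1/2}}{\lambda_k-\lambda_{k+1}}\min\Big(\|\Sigma\|_{\max}^{1/2},\sqrt{\lambda_1}\,\|U\|_{2\to\infty}\Big),$$ $$\mathcal{E}_4=\frac{\lambda_{k+1}}{\lambda_k}\kappa^2\sqrt{\frac{k\log(p)}{n}}+\frac{\lambda_{k+1}}{\lambda_k}\kappa^3\frac{s\log(p)}{n},$$ $$\mathcal{E}_5=\frac{\kappa\lambda_1}{\lambda_k-\lambda_{k+1}}\frac{s\log(p)}{n}+\kappa\sqrt{\frac{k\log(p)}{n}}.$$
   Context: Asymptotic conventions: everything is indexed by the sample size $n\to\infty$; the positive integers $p,s,k$, the matrix $\Sigma$, and $\delta$ may depend on $n$. $f\lesssim g$ (or $f=O(g)$) means there is a constant $C'$ with $f(n)\le C'g(n)$ for all sufficiently large $n$; $f\ll g$ means $f/g\to0$. A bound ''$\lesssim$ with probability at least $q_n$'' means that for some constant $C'$, for all sufficiently large $n$, the inequality with constant $C'$ holds with probability at least $q_n$. ''Sufficiently large constant $C$'' means: there is $C_0$ depending only on $B$ such that the result holds whenever $C\ge C_0$. Norms: $\|X\|_{\psi_2}=\inf\{t>0:\mathbb{E}\exp(X^2/t^2)\le 2\}$ for a real random variable $X$. $\|\cdot\|$ is the Euclidean norm of vectors and the spectral norm of matrices; $\|M\|_{2\to\infty}=\max_i\|M_{i\cdot}\|$ is the maximum Euclidean row norm, where $M_{i\cdot}$ is the $i$-th row; $\|M\|_{\max}$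 is the maximum absolute entry. $\mathbb{O}(k)$ is the set of $k\times k$ orthogonal matrices. Setting: $X_1,\dots,X_n\in\mathbb{R}^p$ are mean-zero with covariance matrix $\Sigma$, whose eigenvalues are $\lambda_1\ge\cdots\ge\lambda_p\ge0$, with $\lambda_k>\lambda_{k+1}$. $U\in\mathbb{R}^{p\times k}$ is a matrix of orthonormal eigenvectors for $\lambda_1,\dots,\lambda_k$. There is a set $J\subset\{1,\dots,p\}$ with $|J|\le s$ such that all rows of $U$ with index outside $J$ are zero. $\hat\Sigma=\frac1n\sum_{i=1}^nX_iX_i^\top$. $M_{JJ}$ denotes the principal submatrix of $M$ with rows and columns in $J$. Procedure: a sparse PCA algorithm (any algorithm) run on $\hat\Sigma$ returns a support estimate $\hat J\subset\{1,\dots,p\}$. Let $\tilde U_{\hat J}$ be a matrix whose columns are $k$ orthonormal leading eigenvectors of $\hat\Sigma_{\hat J\hat J}$, with rows indexed by $\hat J$. The output $\tilde U\in\mathbb{R}^{p\times k}$ has rows $\tilde U_{i\cdot}=(\tilde U_{\hat J})_{i\cdot}$ for $i\in\hat J$ and $\tilde U_{i\cdot}=0$ for $i\notin\hat J$. *)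

(* Defs.v *)
From HB Require Import structures.
From mathcomp Require Import all_boot all_order all_algebra.
From mathcomp Require Import all_classical all_reals all_analysis.
Set Implicit Arguments.
Unset Strict Implicit.
Unset Printing Implicit Defensive.
Import Order.TTheory GRing.Theory Num.Theory.
Import numFieldNormedType.Exports.
Local Open Scope classical_set_scope.
Local Open Scope ring_scope.

Definition asymp_le (R : realType) (f g : nat -> R) : Prop :=
  exists C : R, \forall n \near \oo, f n <= C * g n.

Definition asymp_ll (R : realType) (f g : nat -> R) : Prop :=
  (f n / g n) @[n --> \oo] --> (0 : R).

Section probability.
Context (d : measure_display) (T : measurableType d) (R : realType).
Variable P : probability T R.

Definition psi2_norm (X : T -> R) : \bar R :=
  ereal_inf [set t%:E | t in
    [set t : R | 0 < t /\
      ('E_P[(fun w => expR (X w ^+ 2 / t ^+ 2))] <= 2%:E)%E]].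

Definition independent_classes (I : finType) (F : I -> set_system T) : Prop :=
  forall (K : {set I}) (A : I -> set T), (forall i, i \in K -> F i (A i)) ->
  P (\bigcap_(i in [set i | i \in K]) A i) = (\prod_(i in K) P (A i))%E.

Definition sigma_of (J : Type) (Z : J -> T -> R) : set_system T :=
  <<s \bigcup_j preimage_set_system setT (Z j) measurable >>.

Definition independent_RVs (I : finType) (Z : I -> T -> R) : Prop :=
  independent_classes (fun i => sigma_of (fun _ : unit => Z i)).

Definition independent_vectors (I : finType) (J : Type)
    (Z : I -> J -> T -> R) : Prop :=
  independent_classes (fun i => sigma_of (Z i)).

(* E itself need not be measurable: it may depend on an arbitrary choice of
   eigenvectors, which can be non-unique. *)
Definition prob_at_least (q : R) (E : set T) : Prop :=
  exists A : set T, [/\ measurable A, A `<=` E & (q%:E <= P A)%E].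

End probability.

Section matrices.
Variable R : realType.

Definition row_norm k (v : 'rV[R]_k) : R := Num.sqrt (\sum_j v 0 j ^+ 2).

Definition norm2inf p k (M : 'M[R]_(p, k)) : R :=
  \big[Num.max/0]_(i < p) row_norm (row i M).

Definition orthogonal_mx k (W : 'M[R]_k) : Prop := W^T *m W = 1%:M.

Definition is_psd_sqrt p (A S : 'M[R]_p) : Prop :=
  [/\ S^T = S, forall v : 'cV[R]_p, 0 <= (v^T *m S *m v) 0 0 & S *m S = A].

Definition is_spectrum p (A : 'M[R]_p) (lam : seq R) : Prop :=
  sorted >=%R lam /\ char_poly A = \prod_(x <- lam) ('X - x%:P).

(* 1-based access to the sorted eigenvalues; 0 beyond the dimension. *)
Definition eigval (lam : seq R) (j : nat) : R := lam`_j.-1.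

Definition eigenvectors_for m k (A : 'M[R]_m) (lam : seq R)
    (V : 'M[R]_(m, k)) : Prop :=
  V^T *m V = 1%:M /\
  forall l : 'I_k, A *m col l V = eigval lam l.+1 *: col l V.

Definition leading_eigenvectors m k (A : 'M[R]_m) (V : 'M[R]_(m, k)) : Prop :=
  exists2 lam, is_spectrum A lam & eigenvectors_for A lam V.

Definition sample_cov n p (X : 'I_n -> 'cV[R]_p) : 'M[R]_p :=
  n%:R^-1 *: \sum_(i < n) X i *m (X i)^T.

Definition principal_submx p (J : {set 'I_p}) (M : 'M[R]_p) : 'M[R]_#|J| :=
  mxsub (fun a : 'I_#|J| => enum_val a) (fun a : 'I_#|J| => enum_val a) M.

Definition refit_output p k (S : 'M[R]_p) (J : {set 'I_p})
    (Ut : 'M[R]_(p, k)) : Prop :=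
  exists V : 'M[R]_(#|J|, k),
  [/\ leading_eigenvectors (principal_submx J S) V,
      forall a : 'I_#|J|, row (enum_val a) Ut = row a V
    & forall i, i \notin J -> row i Ut = 0].

Section error_terms.
Variables (n p s k : nat) (Sigma : 'M[R]_p) (lam : seq R) (U : 'M[R]_(p, k)).
Let l1 := eigval lam 1.
Let lk := eigval lam k.
Let lk1 := eigval lam k.+1.
Let kappa := l1 / lk.
Let logp : R := ln p%:R.

Definition error1 : R :=
  kappa * l1 / (lk - lk1) * (s%:R * logp / n%:R) * norm2inf U
  + kappa * k%:R * Num.sqrt (logp / n%:R) * norm2inf U.

Definition error2 : R :=
  l1 ^+ 2 / (lk - lk1) ^+ 2 * (s%:R * logp / n%:R) * norm2inf U.

Definition error3 : R :=
  Num.sqrt (s%:R * logp / n%:R) * (kappa * Num.sqrt l1 / (lk - lk1))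
  * Num.min (Num.sqrt (mx_norm Sigma)) (Num.sqrt l1 * norm2inf U).

Definition error4 : R :=
  lk1 / lk * kappa ^+ 2 * Num.sqrt (k%:R * logp / n%:R)
  + lk1 / lk * kappa ^+ 3 * (s%:R * logp / n%:R).

Definition error5 : R :=
  kappa * l1 / (lk - lk1) * (s%:R * logp / n%:R)
  + kappa * Num.sqrt (k%:R * logp / n%:R).

End error_terms.
End matrices.

(* Main.v *)
Require Import Defs.
From HB Require Import structures.
From mathcomp Require Import all_boot all_order all_algebra.
From mathcomp Require Import all_classical all_reals all_analysis.
From mathcomp Require Import measurable_realfun.
From mathcomp Require Import ring lra.
Set Implicit Arguments.
Unset Strict Implicit.
Unset Printing Implicit Defensive.
Import Order.TTheory GRing.Theory Num.Theory.
Import numFieldNormedType.Exports.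
Local Open Scope classical_set_scope.
Local Open Scope ring_scope.

(** Fix the sample size.  On the event that the support is recovered, the
    estimator restricted to [J] is a matrix [V] of leading eigenvectors of
    [S + E], where [S] is the [J]-block of the covariance matrix and [E] the
    sampling error on that block.  Write [g] for the eigengap
    [lambda_k - lambda_(k+1)] and [kappa] for [lambda_1 / lambda_k]; since
    [lambda_(k+1) <= lambda_k / 2], the ratio [lambda_1 / g] is at most
    [2 * kappa].  The proof shows that, up to a constant depending on [B],
    every row of [V - U W] is bounded by the fifth error term; the other four
    error terms are nonnegative.

    Perturbation.  Split [V = U H + D] with [D] orthogonal to [U], and put
    [F = D H^-1], the matrix of tangents of the principal angles.  It solves a
    Riccati equation ([tangent_riccati]) whose linear part is the Sylvester
    operator [F |-> F Lambda - S_perp F] of the unperturbed matrix; the gap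
    makes this operator invertible with inverse of norm [1 / g]
    ([opnorm_sylvester]).  Hence [F = F1 + O((|E| / g)^2)], where [F1] solves
    the linearised equation, and [H] is within [O((|E| / g)^2)] of an
    orthogonal matrix [W] ([exists_orthogonal_near]).  So the rows of
    [V - U W] are those of [F1 H] up to a quadratic error
    ([eigenspace_row_perturbation]).

    Concentration.  The entries of [F1] are bilinear forms in [E] at
    deterministic vectors of length at most [1 / g] and [1].  Each is
    [O((lambda_1 / g) sqrt (log p / n))], and a row has [k] entries, which gives
    [kappa sqrt (k log p / n)] without any factor [s].  The quadratic error only
    needs the crude estimate [|E| = O(lambda_1 sqrt (s log p / n))], obtained from
    a grid with [p^O(s)] points ([opnorm_le_grid]); its square over [g^2] is
    [kappa (lambda_1 / g) s log p / n].  When [|E| / g] is not small, the fifth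
    error term is bounded below, and all rows have norm at most 2.

    Both estimates are instances of a Bernstein inequality for the quadratic
    form [v^T (Sigmahat - Sigma) v] at one fixed vector ([quad_form_deviation])
    and a union bound ([good_event]).  Bernstein's inequality needs the
    exponential moments of the square of a linear combination of independent
    sub-Gaussian variables, hence the product rule for expectations of
    independent variables ([independent_integral_prod]). *)

(** * Euclidean geometry and the operator norm *)

Section euclid.
Variable R : realType.
Implicit Types m n k : nat.

Definition dot m (u v : 'cV[R]_m) : R := (u^T *m v) 0 0.

Definition vnorm m (v : 'cV[R]_m) : R := Num.sqrt (dot v v).

Lemma dotE m (u v : 'cV[R]_m) : dot u v = \sum_i u i 0 * v i 0.
Proof. by rewrite /dot mxE; apply: eq_bigr => i _; rewrite !mxE. Qed.

Lemma dotC m (u v : 'cV[R]_m) : dot u v = dot v u.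
Proof. by rewrite !dotE; apply: eq_bigr => i _; rewrite mulrC. Qed.

Lemma dotDl m (u v w : 'cV[R]_m) : dot (u + v) w = dot u w + dot v w.
Proof. by rewrite /dot linearD mulmxDl mxE. Qed.

Lemma dotDr m (u v w : 'cV[R]_m) : dot w (u + v) = dot w u + dot w v.
Proof. by rewrite /dot mulmxDr mxE. Qed.

Lemma dotZl m a (u w : 'cV[R]_m) : dot (a *: u) w = a * dot u w.
Proof. by rewrite /dot linearZ -scalemxAl mxE. Qed.

Lemma dotZr m a (u w : 'cV[R]_m) : dot w (a *: u) = a * dot w u.
Proof. by rewrite /dot -scalemxAr mxE. Qed.

Lemma dotNl m (u w : 'cV[R]_m) : dot (- u) w = - dot u w.
Proof. by rewrite -scaleN1r dotZl mulN1r. Qed.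

Lemma dotNr m (u w : 'cV[R]_m) : dot w (- u) = - dot w u.
Proof. by rewrite -scaleN1r dotZr mulN1r. Qed.

Lemma dot0l m (w : 'cV[R]_m) : dot 0 w = 0.
Proof. by rewrite -(scale0r 0) dotZl mul0r. Qed.

Lemma dot0r m (w : 'cV[R]_m) : dot w 0 = 0.
Proof. by rewrite dotC dot0l. Qed.

Lemma dotMl m n (A : 'M[R]_(m, n)) u v : dot (A *m u) v = dot u (A^T *m v).
Proof. by rewrite /dot trmx_mul mulmxA. Qed.

Lemma dot_ge0 m (u : 'cV[R]_m) : 0 <= dot u u.
Proof. by rewrite dotE sumr_ge0// => i _; rewrite -expr2 sqr_ge0. Qed.

Lemma dot_eq0 m (u : 'cV[R]_m) : dot u u = 0 -> u = 0.
Proof.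
rewrite dotE => /psumr_eq0P u0; apply/colP => i; rewrite mxE.
by apply/eqP; rewrite -sqrf_eq0 expr2 u0// => j _; rewrite -expr2 sqr_ge0.
Qed.

Lemma dot_gt0 m (u : 'cV[R]_m) : u != 0 -> 0 < dot u u.
Proof.
by move=> u0; rewrite lt0r dot_ge0 andbT; apply: contra_neq u0; exact: dot_eq0.
Qed.

Lemma dot_isometry m n (Q : 'M[R]_(m, n)) u v :
  Q^T *m Q = 1%:M -> dot (Q *m u) (Q *m v) = dot u v.
Proof. by move=> QQ; rewrite dotMl mulmxA QQ mul1mx. Qed.

Lemma cauchy_schwarz_sq m (u v : 'cV[R]_m) :
  dot u v ^+ 2 <= dot u u * dot v v.
Proof.
have [->|v0] := eqVneq v 0; first by rewrite !dot0r expr0n mulr0.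
have := dot_ge0 (dot v v *: u - dot u v *: v).
rewrite !(dotDl, dotDr, dotNl, dotNr, dotZl, dotZr) (dotC v u) => h.
have c0 := dot_gt0 v0.
rewrite -subr_ge0 -(pmulr_rge0 _ c0) (le_trans h)// le_eqVlt.
by apply/orP; left; apply/eqP; ring.
Qed.

Lemma vnorm_ge0 m (v : 'cV[R]_m) : 0 <= vnorm v. Proof. exact: sqrtr_ge0. Qed.

Lemma sqr_vnorm m (v : 'cV[R]_m) : vnorm v ^+ 2 = dot v v.
Proof. by rewrite sqr_sqrtr// dot_ge0. Qed.

Lemma vnorm0 m : vnorm (0 : 'cV[R]_m) = 0.
Proof. by rewrite /vnorm dot0l sqrtr0. Qed.

Lemma vnorm_eq0 m (v : 'cV[R]_m) : vnorm v = 0 -> v = 0.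
Proof. by move=> v0; apply: dot_eq0; rewrite -sqr_vnorm v0 expr0n. Qed.

Lemma vnorm_gt0 m (v : 'cV[R]_m) : v != 0 -> 0 < vnorm v.
Proof. by move=> v0; rewrite sqrtr_gt0 dot_gt0. Qed.

Lemma cauchy_schwarz m (u v : 'cV[R]_m) : `|dot u v| <= vnorm u * vnorm v.
Proof.
rewrite -sqrtr_sqr /vnorm -sqrtrM ?dot_ge0// ler_sqrt ?mulr_ge0 ?dot_ge0//.
exact: cauchy_schwarz_sq.
Qed.

Lemma vnormD m (u v : 'cV[R]_m) : vnorm (u + v) <= vnorm u + vnorm v.
Proof.
rewrite -ler_sqr ?nnegrE ?addr_ge0 ?vnorm_ge0// sqrrD !sqr_vnorm.
rewrite dotDl !dotDr (dotC v u).
have := le_trans (ler_norm _) (cauchy_schwarz u v); lra.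
Qed.

Lemma vnormZ m a (v : 'cV[R]_m) : vnorm (a *: v) = `|a| * vnorm v.
Proof.
rewrite /vnorm dotZl dotZr mulrA -expr2 sqrtrM ?sqr_ge0//.
by rewrite sqrtr_sqr.
Qed.

Lemma vnormN m (v : 'cV[R]_m) : vnorm (- v) = vnorm v.
Proof. by rewrite /vnorm dotNl dotNr opprK. Qed.

Lemma vnormB m (u v : 'cV[R]_m) : vnorm (u - v) <= vnorm u + vnorm v.
Proof. by rewrite (le_trans (vnormD _ _))// vnormN. Qed.

Lemma vnorm_le_sqr m (v : 'cV[R]_m) c :
  0 <= c -> dot v v <= c ^+ 2 -> vnorm v <= c.
Proof. by move=> c0; rewrite -sqr_vnorm ler_sqr ?nnegrE ?vnorm_ge0. Qed.

Lemma vnorm_isometry m n (Q : 'M[R]_(m, n)) v :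
  Q^T *m Q = 1%:M -> vnorm (Q *m v) = vnorm v.
Proof. by move=> QQ; rewrite /vnorm dot_isometry. Qed.

Lemma row_norm_vnorm m (v : 'rV[R]_m) : row_norm v = vnorm v^T.
Proof.
rewrite /row_norm /vnorm dotE; congr Num.sqrt.
by apply: eq_bigr => i _; rewrite mxE expr2.
Qed.

(** Used only to see that the supremum defining the operator norm is finite. *)
Lemma mulmx_le_frobenius m n (A : 'M[R]_(m, n)) v :
  vnorm (A *m v) <= Num.sqrt (\sum_i \sum_j A i j ^+ 2) * vnorm v.
Proof.
rewrite /vnorm -sqrtrM; last first.
  by apply: sumr_ge0 => i _; apply: sumr_ge0 => j _; exact: sqr_ge0.
apply: ler_wsqrtr; rewrite [leLHS]dotE mulr_suml; apply: ler_sum => i _.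
have -> : (A *m v) i 0 = dot (row i A)^T v by rewrite /dot trmxK -row_mul [RHS]mxE.
rewrite -expr2 (le_trans (cauchy_schwarz_sq _ _))//.
rewrite ler_wpM2r ?dot_ge0// dotE le_eqVlt; apply/orP; left; apply/eqP.
by apply: eq_bigr => j _; rewrite !mxE expr2.
Qed.

Definition opnorm m n (A : 'M[R]_(m, n)) : R :=
  sup [set vnorm (A *m v) | v in [set v : 'cV[R]_n | vnorm v <= 1]].

Lemma opnorm_has_sup m n (A : 'M[R]_(m, n)) :
  has_sup [set vnorm (A *m v) | v in [set v : 'cV[R]_n | vnorm v <= 1]].
Proof.
split; first by exists (vnorm (A *m 0)), 0 => //=; rewrite vnorm0 ler01.
exists (Num.sqrt (\sum_i \sum_j A i j ^+ 2)) => _ [v /= v1 <-].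
by rewrite (le_trans (mulmx_le_frobenius _ _))// ler_piMr// sqrtr_ge0.
Qed.

Lemma opnorm_ge0 m n (A : 'M[R]_(m, n)) : 0 <= opnorm A.
Proof.
rewrite (@le_trans _ _ (vnorm (A *m 0)))// ?vnorm_ge0//.
have [_ h] := opnorm_has_sup A.
by apply: ub_le_sup => //; exists 0 => //=; rewrite vnorm0 ler01.
Qed.

Lemma opnormP m n (A : 'M[R]_(m, n)) v :
  vnorm (A *m v) <= opnorm A * vnorm v.
Proof.
have [->|v0] := eqVneq v 0; first by rewrite mulmx0 !vnorm0 mulr0.
have v0' := vnorm_gt0 v0.
have [_ h] := opnorm_has_sup A.
rewrite -ler_pdivrMr// mulrC -[X in X * _](@ger0_norm _ (vnorm v)^-1); last first.
  by rewrite invr_ge0 vnorm_ge0.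
rewrite -vnormZ scalemxAr; apply: ub_le_sup => //; eexists => //=.
by rewrite vnormZ ger0_norm ?invr_ge0 ?vnorm_ge0// mulVf// gt_eqF.
Qed.

Lemma opnorm_le m n (A : 'M[R]_(m, n)) c : 0 <= c ->
  (forall v, vnorm (A *m v) <= c * vnorm v) -> opnorm A <= c.
Proof.
move=> c0 h; apply: ge_sup; first by have [] := opnorm_has_sup A.
move=> _ [v /= v1 <-]; rewrite (le_trans (h v))// ler_piMr//.
Qed.

Lemma opnorm_mulmxP m n (A : 'M[R]_(m, n)) v c :
  opnorm A <= c -> vnorm (A *m v) <= c * vnorm v.
Proof.
by move=> Ac; rewrite (le_trans (opnormP _ _))// ler_wpM2r// vnorm_ge0.
Qed.

Lemma opnormD m n (A B : 'M[R]_(m, n)) :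
  opnorm (A + B) <= opnorm A + opnorm B.
Proof.
apply: opnorm_le; first by rewrite addr_ge0// opnorm_ge0.
by move=> v; rewrite mulmxDl (le_trans (vnormD _ _))// mulrDl lerD// opnormP.
Qed.

Lemma opnormN m n (A : 'M[R]_(m, n)) : opnorm (- A) = opnorm A.
Proof.
rewrite /opnorm; congr sup.
by apply/seteqP; split => _ [v v1 <-]; exists v => //; rewrite mulNmx vnormN.
Qed.

Lemma opnormB m n (A B : 'M[R]_(m, n)) :
  opnorm (A - B) <= opnorm A + opnorm B.
Proof. by rewrite (le_trans (opnormD _ _))// opnormN. Qed.

Lemma opnormM m n k (A : 'M[R]_(m, n)) (B : 'M[R]_(n, k)) :
  opnorm (A *m B) <= opnorm A * opnorm B.
Proof.
apply: opnorm_le; first by rewrite mulr_ge0// opnorm_ge0.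
move=> v; rewrite -mulmxA (le_trans (opnormP _ _))// -mulrA ler_wpM2l//.
  exact: opnorm_ge0.
exact: opnormP.
Qed.

Lemma opnormM_le m n k (A : 'M[R]_(m, n)) (B : 'M[R]_(n, k)) a b :
  opnorm A <= a -> opnorm B <= b -> opnorm (A *m B) <= a * b.
Proof.
by move=> Aa Bb; rewrite (le_trans (opnormM _ _))// ler_pM// opnorm_ge0.
Qed.

Lemma vnorm_sqr_le_dot m n (A : 'M[R]_(m, n)) u :
  dot (A *m u) (A *m u) <= vnorm u * vnorm (A^T *m (A *m u)).
Proof. by rewrite dotMl (le_trans (ler_norm _))// cauchy_schwarz. Qed.

(** From [|A v|^2 = <v, A^T A v> <= |v| |A^T| |A v|]; the reverse inequality
    is the same statement for the transpose. *)
Lemma opnorm_tr_le m n (A : 'M[R]_(m, n)) : opnorm A <= opnorm A^T.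
Proof.
apply: opnorm_le; first exact: opnorm_ge0.
move=> v; have [->|Av0] := eqVneq (A *m v) 0.
  by rewrite vnorm0 mulr_ge0 ?opnorm_ge0 ?vnorm_ge0.
have n0 := vnorm_gt0 Av0.
rewrite -(ler_pM2r n0) -expr2 sqr_vnorm (le_trans (vnorm_sqr_le_dot _ _))//.
rewrite mulrC [leRHS]mulrAC ler_wpM2r ?vnorm_ge0//.
exact: opnormP.
Qed.

Lemma opnorm_tr m n (A : 'M[R]_(m, n)) : opnorm A^T = opnorm A.
Proof.
apply/eqP; rewrite eq_le opnorm_tr_le andbT.
by rewrite (le_trans (opnorm_tr_le _))// trmxK.
Qed.

Lemma opnorm_isometry m n (Q : 'M[R]_(m, n)) :
  Q^T *m Q = 1%:M -> opnorm Q <= 1.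
Proof.
by move=> QQ; apply: opnorm_le => // v; rewrite vnorm_isometry// mul1r.
Qed.

Lemma row_norm_le_opnorm m n (A : 'M[R]_(m, n)) i :
  row_norm (row i A) <= opnorm A.
Proof.
rewrite row_norm_vnorm -opnorm_tr rowE trmx_mul (le_trans (opnormP _ _))//.
rewrite ler_piMr ?opnorm_ge0// /vnorm dotE (bigD1 i)//= big1 => [|j ji].
  by rewrite !mxE !eqxx mulr1 addr0 sqrtr1.
by rewrite !mxE (negbTE ji) andbF mul0r.
Qed.

Lemma row_normM m n k (A : 'M[R]_(m, n)) (B : 'M[R]_(n, k)) i :
  row_norm (row i (A *m B)) <= row_norm (row i A) * opnorm B.
Proof.
by rewrite row_mul !row_norm_vnorm trmx_mul mulrC -(opnorm_tr B) opnormP.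
Qed.

Lemma row_normD m (u v : 'rV[R]_m) : row_norm (u + v) <= row_norm u + row_norm v.
Proof. by rewrite !row_norm_vnorm linearD vnormD. Qed.

Lemma row_normB m (u v : 'rV[R]_m) : row_norm (u - v) <= row_norm u + row_norm v.
Proof. by rewrite !row_norm_vnorm linearB vnormB. Qed.

Lemma row_norm_ge0 m (u : 'rV[R]_m) : 0 <= row_norm u.
Proof. exact: sqrtr_ge0. Qed.

(** By polarisation: [|E v|] is a multiple of the bilinear form at [v] and the
    image of [v], rescaled to the length of [v]. *)
Lemma opnorm_sym m (E : 'M[R]_m) c : 0 <= c -> E^T = E ->
  (forall v, vnorm v <= 1 -> `|dot v (E *m v)| <= c) -> opnorm E <= c.
Proof.
move=> c0 Es h.
have hq v : `|dot v (E *m v)| <= c * dot v v.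
  have [->|v0] := eqVneq v 0; first by rewrite !dot0l normr0 mulr0.
  have n0 := vnorm_gt0 v0.
  have := h ((vnorm v)^-1 *: v).
  rewrite -scalemxAr dotZl dotZr vnormZ ger0_norm ?invr_ge0 ?vnorm_ge0//.
  rewrite mulVf ?gt_eqF// => /(_ (lexx _)).
  rewrite mulrA -expr2 normrM ger0_norm ?sqr_ge0// exprVn -sqr_vnorm.
  by rewrite mulrC ler_pdivrMr// exprn_gt0.
apply: opnorm_le => // v.
have [->|Ev0] := eqVneq (E *m v) 0; first by rewrite vnorm0 mulr_ge0 ?vnorm_ge0.
have [v0|v0] := eqVneq v 0; first by rewrite v0 mulmx0 eqxx in Ev0.
have a0 := vnorm_gt0 v0; have b0 := vnorm_gt0 Ev0.
(* polarisation between v and the rescaled image of v *)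
pose w := (vnorm v / vnorm (E *m v)) *: (E *m v).
have ww : dot w w = dot v v.
  rewrite /w dotZl dotZr -!sqr_vnorm mulrA -expr2 exprMn exprVn -mulrA.
  by rewrite mulVf ?mulr1// gt_eqF// exprn_gt0.
have wE : dot w (E *m v) = vnorm v * vnorm (E *m v).
  by rewrite /w dotZl -sqr_vnorm expr2 mulrA divfK// gt_eqF.
have hp := ler_normlW (hq (v + w)).
have /ler_normlP[hm _] := hq (v - w).
have sw : dot v (E *m w) = dot w (E *m v) by rewrite -{1}Es -dotMl dotC.
rewrite -(ler_pM2l a0) -wE.
move: hp hm; rewrite mulmxDr mulmxBr !(dotDl, dotDr, dotNl, dotNr) sw ww.
rewrite (dotC w v) -(sqr_vnorm v) mulrCA -expr2; lra.
Qed.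

End euclid.

(** * Spectral theorem and variational bounds for eigenvalues *)

Section spectral.
Variable R : realType.
Implicit Types m n k : nat.

(** A zero of a nonnegative quadratic form is a critical point: otherwise the
    form would become negative along a small step in the direction [w]. *)
Lemma psd_form_critical m (N : 'M[R]_m) (v w : 'cV[R]_m) :
  N^T = N -> (forall a, 0 <= dot (v + a *: w) (N *m (v + a *: w))) ->
  dot v (N *m v) = 0 -> dot w (N *m v) = 0.
Proof.
move=> Ns h v0; set b := dot w _; set c := dot w (N *m w).
have bE : dot v (N *m w) = b by rewrite -{1}Ns -dotMl dotC.
have q a : 0 <= 2 * a * b + a ^+ 2 * c.
  have := h a; rewrite mulmxDr -scalemxAr !(dotDl, dotDr, dotZl, dotZr) v0 bE.
  by rewrite -/b -/c; lra.
apply/eqP; apply: contraT => b0.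
have c1 : 0 < 1 + `|c| by rewrite ltr_pwDl.
(* A step close to the minimiser [- b / c] of the parabola; the denominator
   [1 + `|c|] avoids dividing by zero. *)
have := q (- b / (1 + `|c|)); rewrite leNgt => /negP[].
rewrite (_ : _ + _ = - (b ^+ 2 / (1 + `|c|)) * (2 - c / (1 + `|c|))); last first.
  by field; rewrite gt_eqF.
rewrite nmulr_rlt0 ?subr_gt0 ?ltr_pdivrMr//.
  by have := ler_norm c; lra.
by rewrite oppr_lt0 divr_gt0// exprn_even_gt0.
Qed.

Lemma continuous_quad_form m (N : 'M[R]_m) :
  continuous (fun x : 'rV[R]_m => dot x^T (N *m x^T)).
Proof.
have -> : (fun x : 'rV[R]_m => dot x^T (N *m x^T)) =
    (fun x : 'rV[R]_m => \sum_i \sum_j (x 0 i * (N i j * x 0 j))).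
  apply/funext => x; rewrite dotE; apply: eq_bigr => i _.
  by rewrite !mxE mulr_sumr; apply: eq_bigr => j _; rewrite !mxE.
apply: continuous_big => [|i _]; first exact: add_continuous.
apply: continuous_big => [|j _]; first exact: add_continuous.
move=> x; apply: (@continuousM _ _ (fun x : 'rV[R]_m => x 0 i)
  (fun x : 'rV[R]_m => N i j * x 0 j)); first exact: coord_continuous.
apply: (@continuousM _ _ (fun x : 'rV[R]_m => N i j) (fun x : 'rV[R]_m => x 0 j)).
  exact: cst_continuous.
exact: coord_continuous.
Qed.

Lemma exists_unit_ker m r (Q : 'M[R]_(m, r)) : (r < m)%N ->
  exists2 x : 'rV[R]_m, x *m Q = 0 & dot x^T x^T = 1.
Proof.
move=> rm.
have : kermx Q != 0.
  rewrite kermx_eq0 /row_free neq_ltn (leq_ltn_trans (rank_leq_col _))//.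
case/rowV0Pn => x /sub_kermxP xQ x0.
have xt0 : x^T != 0 by rewrite -(inj_eq trmx_inj) trmxK trmx0.
have n0 := vnorm_gt0 xt0.
exists ((vnorm x^T)^-1 *: x); first by rewrite -scalemxAl xQ scaler0.
rewrite linearZ/= dotZl dotZr -sqr_vnorm mulrA -expr2 exprVn mulVf//.
by rewrite gt_eqF// exprn_gt0.
Qed.

(** The maximiser of the quadratic form over the compact unit sphere of the
    orthogonal complement of the columns of [Q] is an eigenvector: with [t] the
    maximum, [t - M] is nonnegative on that complement, which it preserves, and
    vanishes at the maximiser. *)
Lemma exists_eigenvector_perp m r (M : 'M[R]_m) (Q : 'M[R]_(m, r)) d :
  (r < m)%N -> M^T = M -> M *m Q = Q *m diag_mx d ->
  exists v : 'cV[R]_m, exists t,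
    [/\ dot v v = 1, Q^T *m v = 0 & M *m v = t *: v].
Proof.
move=> rm Ms MQ.
pose A := [set x : 'rV[R]_m | x *m Q = 0 /\ dot x^T x^T = 1].
have cA : closed A.
  rewrite (_ : A = (\bigcap_(j in setT) [set x : 'rV[R]_m | (x *m Q) 0 j = 0])
      `&` [set x : 'rV[R]_m | dot x^T (1%:M *m x^T) = 1]); last first.
    apply/seteqP; split => x /=; rewrite /A/= mul1mx => -[xQ x1]; split => //.
      by move=> j _ /=; rewrite xQ mxE.
    by apply/rowP => j; have /= -> := xQ j I; rewrite mxE.
  apply: closedI.
    apply: closed_bigI => j _.
    apply: (@preimage_closed _ _ (fun x : 'rV[R]_m => (x *m Q) 0 j)
      [set x | x = 0]).
      rewrite (_ : (fun x : 'rV[R]_m => (x *m Q) 0 j) =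
        (fun x : 'rV[R]_m => \sum_i x 0 i * Q i j)); last first.
        by apply/funext => x; rewrite mxE.
      move=> y _; move: y.
      apply: continuous_big => [|i _]; first exact: add_continuous.
      move=> x; apply: (@continuousM _ _ (fun x : 'rV[R]_m => x 0 i)
        (fun x : 'rV[R]_m => Q i j)); first exact: coord_continuous.
      exact: cst_continuous.
    exact: closed_eq.
  apply: (@preimage_closed _ _ (fun x : 'rV[R]_m => dot x^T (1%:M *m x^T)) [set x | x = 1]).
    by move=> y _; exact: continuous_quad_form.
  exact: closed_eq.
have bA : bounded_set A.
  exists 1; split=> // z z1 x [_ x1]; rewrite /= -[`|x|]/(mx_norm x) mx_normrE.
  apply/bigmax_leP; split => [|[i j] _]; first by rewrite ltW// (lt_trans ltr01).
  rewrite /= (le_trans _ (ltW z1))// -(@expr_le1 _ 2)// real_normK ?num_real//.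
  rewrite -x1 dotE (bigD1 j)//= !mxE (ord1 i) -expr2 lerDl.
  by apply: sumr_ge0 => l _; rewrite !mxE -expr2 sqr_ge0.
have A0 : A !=set0.
  by have [x xQ x1] := exists_unit_ker Q rm; exists x.
have [x] := EVT_max_rV A0 (bounded_closed_compact bA cA)
  (continuous_subspaceT (@continuous_quad_form m M)).
rewrite inE => -[xQ x1] xmax.
set t := dot x^T (M *m x^T) in xmax.
pose v := x^T; exists v, t.
have Qv : Q^T *m v = 0 by rewrite /v -trmx_mul xQ trmx0.
split=> //.
pose N := t%:M - M.
have NE y : N *m y = t *: y - M *m y by rewrite mulmxBl mul_scalar_mx.
have Ns : N^T = N by rewrite linearB/= tr_scalar_mx Ms.
have QN y : Q^T *m y = 0 -> Q^T *m (N *m y) = 0.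
  move=> Qy; rewrite NE mulmxBr -scalemxAr Qy scaler0 mulmxA -{1}Ms -trmx_mul MQ.
  by rewrite trmx_mul tr_diag_mx -mulmxA Qy mulmx0 subrr.
have psd y : Q^T *m y = 0 -> 0 <= dot y (N *m y).
  move=> Qy; have [->|y0] := eqVneq y 0; first by rewrite dot0l.
  have n0 := vnorm_gt0 y0.
  rewrite NE dotDr dotNr dotZr subr_ge0.
  have := xmax ((vnorm y)^-1 *: y^T).
  rewrite inE linearZ/= trmxK -scalemxAr !dotZl !dotZr -sqr_vnorm => h.
  have : (vnorm y)^-1 * ((vnorm y)^-1 * dot y (M *m y)) <= t.
    apply: h; split; first by rewrite -scalemxAl -[y^T *m Q]trmxK trmx_mul trmxK Qy trmx0 scaler0.
    by rewrite linearZ/= trmxK dotZl dotZr -sqr_vnorm; field; rewrite gt_eqF.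
  by rewrite mulrA -invfM mulrC ler_pdivrMr ?mulr_gt0// -expr2.
have Nv0 : dot v (N *m v) = 0 by rewrite NE dotDr dotNr dotZr x1 mulr1 subrr.
have : dot (N *m v) (N *m v) = 0.
  apply: psd_form_critical Nv0 => // a; apply: psd.
  by rewrite mulmxDr Qv -scalemxAr QN// scaler0 addr0.
by move/dot_eq0/eqP; rewrite NE subr_eq0 => /eqP.
Qed.

(** Orthonormal eigenvectors are added one at a time, each found in the
    orthogonal complement of the previous ones. *)
Lemma spectral_partial m (M : 'M[R]_m) r : M^T = M -> (r <= m)%N ->
  exists Q : 'M[R]_(m, r), exists d,
    Q^T *m Q = 1%:M /\ M *m Q = Q *m diag_mx d.
Proof.
move=> Ms; elim: r => [|r IH] rm.
  by exists 0, 0; split; [apply/matrixP => -[]|apply/matrixP => i []].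
have [Q [d [QQ MQ]]] := IH (ltnW rm).
have [v [t [v1 Qv Mv]]] := exists_eigenvector_perp rm Ms MQ.
rewrite -addn1; exists (row_mx Q v), (row_mx d t%:M); split.
  rewrite tr_row_mx mul_col_row QQ Qv -[v^T *m Q]trmxK trmx_mul trmxK Qv trmx0.
  have -> : v^T *m v = 1%:M.
    by apply/matrixP => i j; rewrite !ord1 [RHS]mxE -[LHS]/(dot v v) v1.
  by rewrite -scalar_mx_block.
rewrite mul_mx_row MQ Mv diag_mx_row mul_row_block !mulmx0 addr0 add0r.
congr row_mx; apply/colP => i; rewrite !mxE big_ord1 !mxE eqxx.
by rewrite !mulr1n mulrC.
Qed.

Theorem spectral_theorem m (M : 'M[R]_m) : M^T = M ->
  exists Q : 'M[R]_m, exists d,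
    [/\ Q^T *m Q = 1%:M, Q *m Q^T = 1%:M & M = Q *m diag_mx d *m Q^T].
Proof.
move=> Ms; have [Q [d [QQ MQ]]] := spectral_partial Ms (leqnn m).
have QQ' := mulmx1C QQ.
by exists Q, d; split => //; rewrite -MQ -mulmxA QQ' mulmx1.
Qed.

Lemma dot_spectral m (M Q : 'M[R]_m) d v : M = Q *m diag_mx d *m Q^T ->
  dot v (M *m v) = \sum_i d 0 i * (Q^T *m v) i 0 ^+ 2.
Proof.
move=> ->; rewrite -!mulmxA -{1}[Q]trmxK -dotMl dotE; apply: eq_bigr => i _.
by move: (Q^T *m v) => w; rewrite mul_diag_mx !mxE expr2 mulrCA.
Qed.

Lemma dot_orthogonal m (Q : 'M[R]_m) v : Q *m Q^T = 1%:M ->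
  dot v v = \sum_i (Q^T *m v) i 0 ^+ 2.
Proof.
move=> QQ; rewrite -{1}[v]mul1mx -QQ -mulmxA dotMl dotE.
by apply: eq_bigr => i _; rewrite expr2.
Qed.

Lemma char_poly_spectral m (M Q : 'M[R]_m) d :
  Q *m Q^T = 1%:M -> M = Q *m diag_mx d *m Q^T ->
  char_poly M = \prod_(x <- [seq d 0 i | i : 'I_m]) ('X - x%:P).
Proof.
move=> QQ ->; rewrite big_map big_enum/=.
have -> : \prod_(i : 'I_m) ('X - (d 0 i)%:P) = char_poly (diag_mx d).
  rewrite char_poly_trig ?diag_mx_is_trig//.
  by apply: eq_bigr => i _; rewrite mxE eqxx mulr1n.
rewrite /char_poly /char_poly_mx !map_mxM/=.
set P := map_mx _ Q; set P' := map_mx _ Q^T.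
have PP : P *m P' = 1%:M by rewrite -map_mxM QQ map_mx1.
rewrite (_ : _ - _ = P *m ('X%:M - map_mx polyC (diag_mx d)) *m P'); last first.
  by rewrite mulmxBr mulmxBl mul_mx_scalar -scalemxAl PP scalemx1.
rewrite !det_mulmx mulrAC -det_mulmx PP det1 mul1r//.
Qed.

(** Half of the Courant-Fischer principle.  If at most [r - 1] eigenvalues
    exceeded [c], some nonzero vector of the [r]-dimensional range of [T] would be
    orthogonal to all their eigenvectors, and the form there would be at most
    [c] times the squared norm. *)
Lemma eigval_gt_of_form m r (M : 'M[R]_m) lam (T : 'M[R]_(m, r)) c :
  (0 < r)%N -> M^T = M -> is_spectrum M lam ->
  (forall y : 'cV[R]_r, y != 0 ->
    c * dot (T *m y) (T *m y) < dot (T *m y) (M *m (T *m y))) ->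
  c < eigval lam r.
Proof.
case: r T => // j T _ Ms [slam clam] Tpos; rewrite ltNge; apply/negP => lamc.
have [Q [d [_ QQ ME]]] := spectral_theorem Ms.
have pe : perm_eq lam [seq d 0 i | i : 'I_m].
  by apply: prod_XsubC_eq; rewrite -clam (char_poly_spectral QQ ME).
pose I : {set 'I_m} := [set i | c < d 0 i]%SET.
pose big := [pred x : R | c < x].
have cI : (#|I| <= j)%N.
  have -> : #|I| = count big lam.
    rewrite (permP pe) count_map -sum1_count -sum1_card big_enum_cond/=.
    by apply: eq_bigl => i; rewrite inE.
  rewrite -(cat_take_drop j lam) count_cat.
  have -> : count big (drop j lam) = 0%N.
    apply/eqP; rewrite -leqn0 leqNgt -has_count; apply/hasPn => x xd /=.
    rewrite -leNgt (le_trans _ lamc)//.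
    have [jl|/drop_oversize lj] := ltnP j (size lam); last by rewrite lj in xd.
    move: xd; rewrite (drop_nth 0)// inE => /orP[/eqP->//|xd].
    have := slam; rewrite -{1}(cat_take_drop j lam) => /cat_sorted2[_].
    rewrite (drop_nth 0)//= (path_sortedE) => [/andP[/allP/(_ _ xd)]//|].
    by move=> a b e /= ab be; exact: le_trans be ab.
  rewrite addn0 (leq_trans (count_size _ _))// size_take; case: ltnP => //.
pose N := rowsub (fun a : 'I_#|I| => enum_val a) (Q^T *m T).
have [x xN x1] : exists2 x : 'rV[R]_j.+1, x *m N^T = 0 & dot x^T x^T = 1.
  by apply: exists_unit_ker.
have x0 : x^T != 0.
  by apply/eqP => x0; move: x1; rewrite x0 dot0l => /eqP; rewrite eq_sym oner_eq0.
have Nx : N *m x^T = 0 by rewrite -[N]trmxK -trmx_mul xN trmx0.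
have := Tpos _ x0; apply/negP; rewrite -leNgt.
rewrite (dot_spectral _ ME) (dot_orthogonal _ QQ) mulr_sumr.
apply: ler_sum => i _.
have [iI|iI] := boolP (i \in I); last first.
  by rewrite ler_wpM2r ?sqr_ge0//; move: iI; rewrite inE -leNgt.
suff -> : (Q^T *m (T *m x^T)) i 0 = 0 by rewrite expr0n !mulr0.
have /colP/(_ (enum_rank_in iI i)) := Nx.
rewrite mxE [RHS]mxE => <-; rewrite mulmxA mxE.
by apply: eq_bigr => l _; rewrite !mxE enum_rankK_in.
Qed.

Lemma dot_le_eigval1 m (M : 'M[R]_m) lam v :
  M^T = M -> is_spectrum M lam -> dot v (M *m v) <= eigval lam 1 * dot v v.
Proof.
move=> Ms lamP; rewrite leNgt; apply/negP => h.
have v0 : v != 0 by apply: contraTneq h => ->; rewrite !dot0l mulr0 ltxx.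
have vE (y : 'cV[R]_1) : v *m y = y 0 0 *: v.
  by apply/colP => i; rewrite !mxE big_ord1 mulrC.
suff : eigval lam 1 < eigval lam 1 by rewrite ltxx.
apply: (@eigval_gt_of_form _ 1 M _ v) => // y.
move=> y0; rewrite vE -scalemxAr !dotZl !dotZr.
have a2 : 0 < y 0 0 ^+ 2.
  rewrite exprn_even_gt0//=; apply: contra_neq y0 => y0.
  by apply/colP => i; rewrite !ord1 y0 mxE.
by move: h; rewrite -(ltr_pM2l a2); lra.
Qed.

(** Nonnegativity covers indices beyond the length of the list, where [eigval]
    is 0. *)
Lemma eigval_nonincreasing lam i j : sorted (>=%R : rel R) lam -> {in lam, forall x, 0 <= x} ->
  (0 < i <= j)%N -> eigval lam j <= eigval lam i.
Proof.
move=> slam lam0 /andP[i0 ij]; rewrite /eigval.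
have [jl|lj] := ltnP j.-1 (size lam); last first.
  rewrite nth_default//.
  have [il|li] := ltnP i.-1 (size lam); first by apply: lam0; exact: mem_nth.
  by rewrite nth_default.
have ij' : (i.-1 <= j.-1)%N by case: (i) (j) i0 ij => [|?] [|?].
have tr : transitive (>=%R : rel R) by move=> a b e /= ab be; exact: le_trans be ab.
apply: (sorted_leq_nth tr (fun x => lexx x) 0 slam) => //.
by rewrite inE (leq_ltn_trans ij').
Qed.

Lemma eigval_ge_of_form m r (M : 'M[R]_m) lam (T : 'M[R]_(m, r)) c :
  (0 < r)%N -> M^T = M -> is_spectrum M lam -> T^T *m T = 1%:M ->
  (forall y, c * dot y y <= dot (T *m y) (M *m (T *m y))) ->
  c <= eigval lam r.
Proof.
move=> r0 Ms lamM TT h; apply/ler_addgt0Pl => e e0.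
rewrite -lerBlDl ltW//; apply: (eigval_gt_of_form r0 Ms lamM (T := T)) => y y0.
rewrite dot_isometry// (lt_le_trans _ (h y))// ltr_pM2r ?dot_gt0//.
by rewrite ltrBlDr ltrDl.
Qed.

Lemma dot_diag_mx k (d : 'rV[R]_k) y :
  dot y (diag_mx d *m y) = \sum_l d 0 l * y l 0 ^+ 2.
Proof.
by rewrite dotE; apply: eq_bigr => l _; rewrite mul_diag_mx mxE mulrCA expr2.
Qed.

Section top_eigenvectors.
Variables (m k : nat) (M : 'M[R]_m) (lam : seq R) (U : 'M[R]_(m, k)).

Definition top_diag : 'rV[R]_k := \row_l eigval lam l.+1.

Lemma eigenvectors_forE : eigenvectors_for M lam U ->
  M *m U = U *m diag_mx top_diag.
Proof.
move=> eU; apply/matrixP => i j; have [_ /(_ j)/colP/(_ i)] := eU.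
rewrite mul_mx_diag !mxE mulrC => <-.
by apply: eq_bigr => l _; rewrite mxE.
Qed.

Hypotheses (Ms : M^T = M) (lamM : is_spectrum M lam)
  (lam0 : {in lam, forall x, 0 <= x}) (eU : eigenvectors_for M lam U).

Lemma top_diag_ge l : eigval lam k <= top_diag 0 l.
Proof.
rewrite mxE; apply: eigval_nonincreasing => //; first by case: lamM.
by rewrite /= ltn_ord.
Qed.

(** Any vector orthogonal to the first eigenvectors that violated the bound
    would, together with them, span too large a space on which the quadratic
    form exceeds the next eigenvalue. *)
Lemma dot_tail_le v : eigval lam k.+1 < eigval lam k ->
  U^T *m v = 0 -> dot v (M *m v) <= eigval lam k.+1 * dot v v.
Proof.
move=> gap Uv; rewrite leNgt; apply/negP => h.
have v0 : v != 0 by apply: contraTneq h => ->; rewrite !dot0l mulr0 ltxx.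
have [UU _] := eU.
have MUU := eigenvectors_forE eU.
suff : eigval lam k.+1 < eigval lam (k + 1) by rewrite addn1 ltxx.
have vE (b : 'cV[R]_1) : v *m b = b 0 0 *: v.
  by apply/colP => i; rewrite !mxE big_ord1 mulrC.
have k1 : (0 < k + 1)%N by rewrite addn1.
apply: (eigval_gt_of_form k1 Ms lamM (T := row_mx U v)) => y.
rewrite -[y]vsubmxK; set a := usubmx y; set b := dsubmx y => y0.
rewrite mul_row_col.
rewrite vE; set c := b 0 0.
have dUv w : dot (U *m w) v = 0 by rewrite dotMl Uv dot0r.
have dMv w : dot (U *m w) (M *m v) = 0.
  by rewrite -{1}Ms -dotMl mulmxA MUU -mulmxA dUv.
rewrite mulmxDr -scalemxAr mulmxA MUU -mulmxA.
rewrite !(dotDl, dotDr, dotZl, dotZr) dUv (dotC v) dUv dMv (dotC v) dUv.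
rewrite !dot_isometry// dot_diag_mx !mulr0 !addr0 !add0r mulrDr.
have ha : eigval lam k.+1 * dot a a <= \sum_l top_diag 0 l * a l 0 ^+ 2 ?= iff (a == 0).
  split.
    rewrite dotE mulr_sumr; apply: ler_sum => l _.
    by rewrite -expr2 ler_wpM2r ?sqr_ge0// (le_trans (ltW gap))// top_diag_ge.
  have [->|a0] := eqVneq a 0.
    by rewrite dot0l mulr0 big1 ?eqxx// => l _; rewrite [X in _ * X ^+ 2]mxE expr0n mulr0.
  rewrite lt_eqF// (@lt_le_trans _ _ (eigval lam k * dot a a))//.
    by rewrite ltr_pM2r// dot_gt0.
  rewrite dotE mulr_sumr; apply: ler_sum => l _.
  by rewrite -expr2 ler_wpM2r ?sqr_ge0// top_diag_ge.
have [c0|c0] := eqVneq c 0.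
  rewrite c0 !mul0r mulr0 !addr0 (lt_leif ha).
  apply: contra_neq y0 => a0; apply/colP => i; rewrite a0.
  have -> : b = 0 by apply/colP => j; rewrite !ord1 [RHS]mxE.
  by rewrite col_mx0.
rewrite ler_ltD//; first by case: ha.
rewrite mulrCA (mulrCA (eigval _ _) c) !(mulrA c c) -expr2 ltr_pM2l//.
by rewrite exprn_even_gt0.
Qed.

End top_eigenvectors.

End spectral.

(** * Perturbation of eigenspaces, row by row *)

Section perturbation.
Variable R : realType.
Implicit Types m k : nat.

(** A matrix bounded below has trivial kernel, and the lower bound is an upper
    bound for the inverse. *)
Lemma coercive_unitmx m (A : 'M[R]_m) g : 0 < g ->
  (forall v, g * vnorm v <= vnorm (A *m v)) ->
  A \in unitmx /\ opnorm (invmx A) <= g^-1.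
Proof.
move=> g0 h.
have Au : A \in unitmx.
  rewrite -unitmx_tr -row_free_unit -kermx_eq0; apply/negPn/negP => /rowV0Pn.
  case=> x /sub_kermxP xA; apply/negP; rewrite negbK.
  rewrite -(inj_eq trmx_inj) trmx0; apply/eqP/vnorm_eq0/eqP.
  rewrite eq_le vnorm_ge0 andbT -(ler_pM2l g0) mulr0 (le_trans (h _))//.
  by rewrite -[A]trmxK -trmx_mul xA trmx0 vnorm0.
split=> //; apply: opnorm_le => [|v]; first by rewrite invr_ge0 ltW.
rewrite mulrC ler_pdivlMr// mulrC (le_trans (h _))// mulmxA mulmxV//.
by rewrite mul1mx.
Qed.

Lemma dot_deltal m i (v : 'cV[R]_m) : dot (delta_mx i 0) v = v i 0.
Proof.
rewrite dotE (bigD1 i)//= big1 => [|j ji]; first by rewrite mxE !eqxx mul1r addr0.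
by rewrite mxE (negbTE ji) mul0r.
Qed.

Lemma eq_cols m n (A B : 'M[R]_(m, n)) :
  (forall j, col j A = col j B) -> A = B.
Proof.
by move=> h; apply/matrixP => i j; have /colP/(_ i) := h j; rewrite !mxE.
Qed.

(** The orthogonal factor of the polar decomposition, [H (H^T H)^(-1/2)]; the
    inverse square root comes from the spectral theorem. *)
Lemma exists_orthogonal_near k (H : 'M[R]_k) c : 0 <= c <= 2^-1 ->
  (forall y, (1 - c) * dot y y <= dot (H *m y) (H *m y) <= dot y y) ->
  exists2 W, orthogonal_mx W & opnorm (H - W) <= 2 * c.
Proof.
move=> /andP[c0 c2] h.
have Ns : (H^T *m H)^T = H^T *m H by rewrite trmx_mul trmxK.
have [Q [d [QQ QQ' NE]]] := spectral_theorem Ns.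
have dE i : 1 - c <= d 0 i <= 1.
  pose e := Q *m (delta_mx i 0 : 'cV[R]_k).
  have := h e; rewrite [X in _ <= X <= _]dotMl mulmxA (dot_spectral _ NE).
  rewrite /e dot_isometry// mulmxA QQ mul1mx.
  rewrite dot_deltal (bigD1 i)//= big1 => [|j ji].
    by rewrite !mxE !eqxx addr0 !mulr1 expr1n mulr1.
  by rewrite mxE (negbTE ji) andFb expr0n mulr0.
have d0 i : 0 < d 0 i by have /andP[h1 _] := dE i; lra.
pose r i := Num.sqrt (d 0 i).
have r2 i : r i ^+ 2 = d 0 i by rewrite sqr_sqrtr// ltW.
have r0 i : 0 < r i by rewrite sqrtr_gt0.
pose T := Q *m diag_mx (\row_i (r i)^-1) *m Q^T.
have Ts : T^T = T by rewrite !trmx_mul trmxK tr_diag_mx mulmxA.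
exists (H *m T).
  rewrite /orthogonal_mx trmx_mul Ts !mulmxA -(mulmxA T) NE /T.
  rewrite !mulmxA -(mulmxA _ Q^T Q) QQ mulmx1 -(mulmxA _ Q^T Q) QQ mulmx1.
  rewrite -!(mulmxA Q) !mulmx_diag -[RHS]QQ'; congr (_ *m _).
  rewrite -[RHS]mul1mx -diag_const_mx; congr (diag_mx _ *m _).
  apply/rowP => i; rewrite !mxE -r2; field; rewrite gt_eqF//.
have H1 : opnorm H <= 1.
  apply: opnorm_le => // v; rewrite mul1r; apply: vnorm_le_sqr.
    exact: vnorm_ge0.
  by rewrite sqr_vnorm; have /andP[] := h v.
rewrite -[H in H - _]mulmx1 -mulmxBr (le_trans (opnormM _ _))//.
rewrite (@le_trans _ _ (opnorm (1%:M - T)))// ?ler_piMl ?opnorm_ge0//.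
apply: opnorm_le => [|v]; first by rewrite mulr_ge0.
apply: vnorm_le_sqr; first by rewrite !mulr_ge0// vnorm_ge0.
have -> : 1%:M - T = Q *m diag_mx (\row_i (1 - (r i)^-1)) *m Q^T.
  rewrite -{1}QQ' -{1}[Q]mulmx1 -diag_const_mx -mulmxBl -mulmxBr -linearB.
  by congr (_ *m diag_mx _ *m _); apply/rowP => i; rewrite !mxE.
rewrite -!mulmxA dot_isometry// exprMn sqr_vnorm (dot_orthogonal v QQ').
rewrite dotE mulr_sumr; apply: ler_sum => i _; rewrite -expr2 mul_diag_mx mxE.
rewrite exprMn ler_wpM2r ?sqr_ge0// mxE -ler_sqrt ?sqr_ge0//.
rewrite !sqrtr_sqr (@ger0_norm _ (2 * c)) ?mulr_ge0//.
have /andP[h1 h2] := dE i; have := r2 i; have := r0 i; move: (r i) => x x0 x2.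
have x1 : x <= 1 by rewrite -(@expr_le1 _ 2)// ?x2// ltW.
have xx : x ^+ 2 <= x by rewrite expr2 ler_piMl// ltW.
have xi : x^-1 <= 1 + 2 * c.
  rewrite -div1r ler_pdivrMr//; nra.
have xi1 : 1 <= x^-1 by rewrite invf_ge1.
by rewrite ler_norml; apply/andP; split; lra.
Qed.

Lemma opnorm_diag_mx_inv k (t : 'rV[R]_k) c : 0 < c -> (forall j, c <= t 0 j) ->
  opnorm (diag_mx (\row_j (t 0 j)^-1)) <= c^-1.
Proof.
move=> c0 tc; have ci : 0 <= c^-1 by rewrite invr_ge0 ltW.
apply: opnorm_le => // v; apply: vnorm_le_sqr; first by rewrite mulr_ge0 ?vnorm_ge0.
rewrite exprMn sqr_vnorm !dotE mulr_sumr; apply: ler_sum => i _.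
rewrite mul_diag_mx !mxE -!expr2 exprMn ler_wpM2r ?sqr_ge0//.
have t0 : 0 < t 0 i by rewrite (lt_le_trans c0).
by rewrite ler_sqr ?nnegrE ?invr_ge0 ?(ltW t0) ?(ltW c0)// lef_pV2.
Qed.

(** Solving for [X diag t] and dividing by [diag t] bounds [|X|] by
    [(|Z| + mu |X|) / c]; the gap [mu < c] absorbs the last term. *)
Lemma opnorm_sylvester m k (X Z : 'M[R]_(m, k)) (S : 'M[R]_m) t c mu :
  X *m diag_mx t - S *m X = Z -> opnorm S <= mu -> 0 <= mu < c ->
  (forall j, c <= t 0 j) -> opnorm X <= opnorm Z / (c - mu).
Proof.
move=> XE Smu /andP[mu0 muc] tc; have c0 : 0 < c := le_lt_trans mu0 muc.
have XE' : X = (Z + S *m X) *m diag_mx (\row_j (t 0 j)^-1).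
  rewrite -XE subrK -mulmxA mulmx_diag -[LHS]mulmx1 -diag_const_mx.
  congr (_ *m diag_mx _); apply/rowP => j; rewrite !mxE divff// gt_eqF//.
  exact: lt_le_trans (tc j).
have : opnorm X <= (opnorm Z + mu * opnorm X) * c^-1.
  rewrite {1}XE'; apply: opnormM_le; last exact: opnorm_diag_mx_inv.
  rewrite (le_trans (opnormD _ _))// lerD2l; exact: opnormM_le.
rewrite ler_pdivlMr// => h; rewrite ler_pdivlMr ?subr_gt0//; lra.
Qed.

Definition perp_proj m k (U : 'M[R]_(m, k)) : 'M[R]_m := 1%:M - U *m U^T.

(** On the orthogonal complement of [U] this is the usual reduced resolvent;
    with the compression of [S] in place of [S] it exists also when [a] is an
    eigenvalue of [S] on the range of [U]. *)
Definition reduced_resolvent m k (S : 'M[R]_m) (U : 'M[R]_(m, k)) a : 'M[R]_m :=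
  invmx (a%:M - perp_proj U *m S *m perp_proj U).

Section subspace.
Variables (m k : nat) (S : 'M[R]_m) (U : 'M[R]_(m, k)) (l : 'rV[R]_k).
Variables (lk mu : R).
Hypotheses (Ss : S^T = S) (UU : U^T *m U = 1%:M)
  (SU : S *m U = U *m diag_mx l) (l_ge : forall j, lk <= l 0 j)
  (mu_lk : 0 <= mu < lk)
  (S_perp : forall v, U^T *m v = 0 -> 0 <= dot v (S *m v) <= mu * dot v v).
Local Notation P := (perp_proj U).

Lemma perp_proj_sym : P^T = P.
Proof. by rewrite linearB/= trmx1 trmx_mul trmxK. Qed.

Lemma mul_tr_perp_proj : U^T *m P = 0.
Proof. by rewrite mulmxBr mulmx1 mulmxA UU mul1mx subrr. Qed.

Lemma perp_proj_idem : P *m P = P.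
Proof.
by rewrite {1}/perp_proj mulmxBl mul1mx -mulmxA mul_tr_perp_proj mulmx0 subr0.
Qed.

Lemma opnorm_perp_proj : opnorm P <= 1.
Proof.
apply: opnorm_le => // v; rewrite mul1r.
have [->|Pv] := eqVneq (P *m v) 0; first by rewrite vnorm0 vnorm_ge0.
rewrite -(ler_pM2r (vnorm_gt0 Pv)) -expr2 sqr_vnorm dotMl.
rewrite perp_proj_sym mulmxA perp_proj_idem.
exact: le_trans (ler_norm _) (cauchy_schwarz _ _).
Qed.

Lemma perp_proj_comm : S *m P = P *m S.
Proof.
rewrite mulmxBr mulmxBl mulmx1 mul1mx mulmxA SU; congr (_ - _).
by rewrite -[in RHS]Ss -!mulmxA -trmx_mul SU trmx_mul tr_diag_mx.
Qed.

(** The compressed matrix sees only vectors orthogonal to [U]. *)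
Lemma opnorm_compression : opnorm (P *m S *m P) <= mu.
Proof.
have /andP[mu0 _] := mu_lk.
apply: opnorm_sym => //.
  by rewrite !trmx_mul Ss perp_proj_sym mulmxA.
move=> v v1; rewrite -!mulmxA -{1}perp_proj_sym -dotMl.
have Uv : U^T *m (P *m v) = 0 by rewrite mulmxA mul_tr_perp_proj mul0mx.
have /andP[h1 h2] := S_perp Uv.
rewrite ger0_norm// (le_trans h2)// ler_piMr// -sqr_vnorm expr_le1//.
  by rewrite (le_trans (opnormP _ _))// mulr_ile1 ?opnorm_ge0 ?vnorm_ge0// opnorm_perp_proj.
exact: vnorm_ge0.
Qed.

Lemma reduced_resolventP a : lk <= a ->
  a%:M - P *m S *m P \in unitmx /\
  opnorm (reduced_resolvent S U a) <= (lk - mu)^-1.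
Proof.
move=> la; have /andP[mu0 ml] := mu_lk.
apply: coercive_unitmx; first by rewrite subr_gt0.
move=> v; rewrite mulmxBl mul_scalar_mx.
have := opnorm_mulmxP v opnorm_compression.
have a0 : 0 <= a by rewrite (le_trans mu0)// (le_trans (ltW ml)).
have : a * vnorm v <= vnorm (a *: v - P *m S *m P *m v) + vnorm (P *m S *m P *m v).
  rewrite -[X in X * _](ger0_norm a0) -vnormZ.
  by rewrite (le_trans _ (vnormD _ _))// subrK.
have : lk * vnorm v <= a * vnorm v by rewrite ler_wpM2r// vnorm_ge0.
lra.
Qed.

Lemma opnorm_reduced_resolvent a : lk <= a ->
  opnorm (P *m reduced_resolvent S U a) <= (lk - mu)^-1.
Proof.
move=> la; have [_ h] := reduced_resolventP la.
by rewrite -[leRHS]mul1r opnormM_le// opnorm_perp_proj.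
Qed.

Section eigenspaces.
Variables (E : 'M[R]_m) (V : 'M[R]_(m, k)) (t : 'rV[R]_k) (eps beta : R).
Hypotheses (E_eps : opnorm E <= eps * (lk - mu)) (VV : V^T *m V = 1%:M)
  (SEV : (S + E) *m V = V *m diag_mx t) 
  (t_ge : forall j, lk - eps * (lk - mu) <= t 0 j) (eps_small : eps <= 8^-1).
Hypothesis (first_order : forall i j,
  `|dot (P *m reduced_resolvent S U (l 0 j) *m delta_mx i 0) (E *m col j U)|
    <= beta).
Let D := P *m V.
Let H := U^T *m V.

Local Lemma gap_gt0 : 0 < lk - mu.
Proof. by rewrite subr_gt0; have /andP[] := mu_lk. Qed.

Local Lemma eps_ge0 : 0 <= eps.
Proof.
by rewrite -(pmulr_lge0 _ gap_gt0) (le_trans _ E_eps)// opnorm_ge0.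
Qed.

Lemma eigenspace_decomp : V = U *m H + D.
Proof. by rewrite /D /H mulmxBl mul1mx mulmxA addrC subrK. Qed.

(** Projecting [(S + E) V = V diag t] on the complement of [U]. *)
Lemma perp_part_sylvester : D *m diag_mx t - (P *m S *m P) *m D = P *m E *m V.
Proof.
have -> : P *m S *m P *m D = P *m S *m V.
  rewrite mulmxA -(mulmxA _ P P) perp_proj_idem -(mulmxA P S P) perp_proj_comm.
  by rewrite (mulmxA P P) perp_proj_idem.
by rewrite /D -mulmxA -SEV (mulmxDl S) (mulmxDr P) !mulmxA addrAC subrr add0r.
Qed.

(** The bound of Davis and Kahan for the sine of the angles. *)
Lemma opnorm_perp_part : opnorm D <= 2 * eps.
Proof.
have ml := gap_gt0; have /andP[mu0 _] := mu_lk.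
have g0 : 0 < lk - eps * (lk - mu) - mu.
  have : 0 < (lk - mu) * (1 - eps) by rewrite mulr_gt0//; move: eps_small; lra.
  lra.
have h : opnorm D <= opnorm (P *m E *m V) / (lk - eps * (lk - mu) - mu).
  apply: (opnorm_sylvester perp_part_sylvester opnorm_compression) => //.
  by rewrite mu0/= -subr_gt0.
rewrite (le_trans h)// ler_pdivrMr//.
have PE : opnorm (P *m E) <= 1 * (eps * (lk - mu)).
  by apply: opnormM_le => //; exact: opnorm_perp_proj.
rewrite (le_trans (opnormM_le PE (opnorm_isometry VV)))//.
have : 0 <= eps * (lk - mu) * (1 - 2 * eps).
  by rewrite !mulr_ge0 ?eps_ge0 ?(ltW ml)//; move: eps_small; lra.
lra.
Qed.

(** Pythagoras: [|y|^2 = |V y|^2 = |H y|^2 + |D y|^2]. *)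
Lemma overlap_bounds y :
  (1 - (2 * eps) ^+ 2) * dot y y <= dot (H *m y) (H *m y) <= dot y y.
Proof.
have UD : U^T *m D = 0 by rewrite mulmxA mul_tr_perp_proj mul0mx.
have yE : dot y y = dot (H *m y) (H *m y) + dot (D *m y) (D *m y).
  rewrite -(dot_isometry y y VV) {1 2}eigenspace_decomp mulmxDl -mulmxA.
  rewrite !(dotDl, dotDr) dot_isometry// (dotMl U) (mulmxA U^T) UD mul0mx dot0r.
  by rewrite (dotC (D *m y) (U *m _)) (dotMl U) (mulmxA U^T) UD mul0mx dot0r addr0 add0r.
have : dot (D *m y) (D *m y) <= (2 * eps) ^+ 2 * dot y y.
  rewrite -!sqr_vnorm -exprMn ler_sqr ?nnegrE ?mulr_ge0 ?vnorm_ge0 ?eps_ge0//.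
  exact: opnorm_mulmxP opnorm_perp_part.
have := dot_ge0 (D *m y); rewrite yE => h1 h2; apply/andP; split; lra.
Qed.

Lemma overlap_unitmx : H \in unitmx /\ opnorm (invmx H) <= 2.
Proof.
have -> : 2 = 2^-1^-1 :> R by rewrite invrK.
apply: coercive_unitmx => [|v]; first by rewrite invr_gt0.
rewrite -ler_sqr ?nnegrE ?mulr_ge0 ?vnorm_ge0 ?invr_ge0// exprMn !sqr_vnorm.
have /andP[h _] := overlap_bounds v; rewrite (le_trans _ h)// ler_wpM2r ?dot_ge0//.
by have := eps_ge0; have := eps_small; nra.
Qed.

Let F := D *m invmx H.

Lemma opnorm_tangent : opnorm F <= 4 * eps.
Proof.
rewrite (le_trans (opnormM_le opnorm_perp_part (proj2 overlap_unitmx)))//.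
by rewrite mulrAC -natrM.
Qed.

Lemma tangent_decomp : V = (U + F) *m H.
Proof.
rewrite mulmxDl /F -(mulmxA D) mulVmx ?mulmx1; last by case: overlap_unitmx.
exact: eigenspace_decomp.
Qed.

(** Writing [V = (U + F) H] removes the perturbed eigenvalues: the component
    of the eigenvalue equation along [U] expresses [H diag t] through [H] and
    [diag l], and [H] then cancels from the component orthogonal to [U].  The
    linear part of the result involves the unperturbed matrix alone, so that
    its solution has deterministic coefficients. *)
Lemma tangent_riccati : F *m diag_mx l - (P *m S *m P) *m F =
  P *m E *m U + (P *m E *m F - F *m U^T *m E *m (U + F)).
Proof.
have [Hu _] := overlap_unitmx.
have FH : F *m H = D by rewrite /F -mulmxA mulVmx// mulmx1.
have HT : H *m diag_mx t = diag_mx l *m H + U^T *m E *m V.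
  rewrite /H -(mulmxA U^T V) -SEV (mulmxDl S) (mulmxDr U^T) !mulmxA; congr (_ *m _ + _).
  by rewrite -[in LHS]Ss -trmx_mul SU trmx_mul tr_diag_mx.
have DT : D *m diag_mx t = F *m (diag_mx l *m H) + F *m (U^T *m E *m V).
  by rewrite -FH -mulmxA HT mulmxDr.
apply: (can_inj (mulmxK Hu)); rewrite addrA -mulmxDr.
rewrite (mulmxBl (F *m _)) (mulmxBl (P *m E *m _)).
rewrite -(mulmxA F (diag_mx l)) -(mulmxA _ F H) FH.
rewrite -(mulmxA (P *m E)) -(mulmxA (F *m U^T *m E)) -tangent_decomp.
rewrite -perp_part_sylvester DT addrAC; congr (_ - _).
by rewrite !mulmxA addrK.
Qed.

Let F1 : 'M[R]_(m, k) := \matrix_(i, j)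
  dot (P *m reduced_resolvent S U (l 0 j) *m delta_mx i 0) (E *m col j U).

(** Column by column the linearised equation is a linear system with matrix
    [l_j - P S P], solved by the reduced resolvent; its symmetry turns the entries
    of the solution into the bilinear forms that define [F1]. *)
Lemma first_order_sylvester : F1 *m diag_mx l - (P *m S *m P) *m F1 = P *m E *m U.
Proof.
have F1E j : col j F1 = reduced_resolvent S U (l 0 j) *m (P *m E *m col j U).
  apply/colP => i; rewrite !mxE.
  set X := reduced_resolvent _ _ _.
  have Xs : X^T = X.
    rewrite /X /reduced_resolvent trmx_inv linearB/= tr_scalar_mx.
    by rewrite !trmx_mul Ss perp_proj_sym mulmxA.
  rewrite -mulmxA dotMl perp_proj_sym dotMl Xs -mulmxA.
  by rewrite dot_deltal [LHS]mxE.
have colM p q r (A : 'M[R]_(p, q)) (B : 'M[R]_(q, r)) j : col j (A *m B) = A *m col j B.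
  by rewrite !colE mulmxA.
apply: eq_cols => j; rewrite linearB/= !colM.
have -> : F1 *m col j (diag_mx l) = l 0 j *: col j F1.
  rewrite -colM; apply/colP => i; rewrite mul_mx_diag !mxE mulrC//.
have [Au _] := reduced_resolventP (l_ge j).
by rewrite -mul_scalar_mx -mulmxBl F1E mulKVmx.
Qed.

(** Only the rows of the first-order term [F1] enter with their own size; the
    remainder of the Riccati equation and the distance from [H] to the
    orthogonal group are quadratic in [eps] in operator norm. *)
Theorem eigenspace_row_perturbation : exists2 W, orthogonal_mx W &
  forall i, row_norm (row i (V - U *m W)) <=
    Num.sqrt k%:R * beta + 18 * eps ^+ 2.
Proof.
have e0 := eps_ge0; have e8 := eps_small.
have c0 : 0 <= (2 * eps) ^+ 2 <= 2^-1 by rewrite sqr_ge0/=; nra.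
have [W WW HW] := exists_orthogonal_near c0 overlap_bounds.
exists W => // i.
have H1 : opnorm H <= 1.
  apply: opnorm_le => // v; rewrite mul1r; apply: vnorm_le_sqr.
    exact: vnorm_ge0.
  by rewrite sqr_vnorm; have /andP[] := overlap_bounds v.
have -> : V - U *m W = F1 *m H + ((F - F1) *m H + U *m (H - W)).
  rewrite {1}tangent_decomp (mulmxDl U F H) (mulmxBl F F1 H) (mulmxBr U H W).
  rewrite [RHS]addrA (addrC (F1 *m H)) subrK (addrC (U *m H) (F *m H)).
  by rewrite [RHS]addrA.
rewrite linearD/= (le_trans (row_normD _ _))//; apply: lerD.
  rewrite (le_trans (row_normM _ _ _))//.
  rewrite (@le_trans _ _ (row_norm (row i F1)))// ?ler_piMr ?row_norm_ge0//.
  have b0 : k%:R * beta ^+ 2 = \sum_(j < k) beta ^+ 2 by rewrite sumr_const card_ord mulr_natl.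
  have [k0|k0] := posnP k.
    rewrite /row_norm big1 ?sqrtr0 ?k0 ?sqrtr0 ?mul0r// => j.
    by move: (ltn_ord j); rewrite {2}k0.
  have beta0 : 0 <= beta.
    by rewrite (le_trans _ (first_order i (Ordinal k0))).
  rewrite -[X in _ <= _ * X](ger0_norm beta0) -sqrtr_sqr -sqrtrM// ler_wsqrtr// b0.
  apply: ler_sum => j _; rewrite !mxE -real_normK ?num_real//.
  rewrite ler_sqr ?nnegrE//; exact: first_order.
(* The difference to the first-order solution solves the same Sylvester
   equation with the quadratic part of the Riccati equation on the right. *)
have F2E : (F - F1) *m diag_mx l - (P *m S *m P) *m (F - F1) =
    P *m E *m F - F *m U^T *m E *m (U + F).
  apply: (addrI (P *m E *m U)); rewrite -tangent_riccati -first_order_sylvester.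
  rewrite (mulmxBl F F1) (mulmxBr _ F F1).
  move: (F *m _) (_ *m F) (F1 *m _) (_ *m F1) => a b c d.
  by apply/matrixP => i' j; rewrite !mxE; ring.
have [mu0 ml] := andP mu_lk.
have F2 : opnorm (F - F1) <= 10 * eps ^+ 2.
  rewrite (le_trans (opnorm_sylvester F2E opnorm_compression _ l_ge))//.
  rewrite ler_pdivrMr ?gap_gt0// (le_trans (opnormB _ _))//.
  have h1 : opnorm (P *m E *m F) <= 1 * (eps * (lk - mu)) * (4 * eps).
    apply: opnormM_le opnorm_tangent; apply: opnormM_le => //.
    exact: opnorm_perp_proj.
  have h2 : opnorm (F *m U^T *m E *m (U + F)) <= 4 * eps * 1 * (eps * (lk - mu)) * (3 / 2).
    apply: opnormM_le; last first.
      rewrite (le_trans (opnormD _ _))//.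
      by move: (opnorm_isometry UU) opnorm_tangent eps_small; lra.
    apply: opnormM_le => //; apply: opnormM_le; first exact: opnorm_tangent.
    by rewrite opnorm_tr opnorm_isometry.
  by rewrite (le_trans (lerD h1 h2))//; lra.
rewrite (le_trans (row_norm_le_opnorm _ _))// (le_trans (opnormD _ _))//.
have h1 : opnorm ((F - F1) *m H) <= 10 * eps ^+ 2 * 1.
  exact: opnormM_le.
have h2 : opnorm (U *m (H - W)) <= 1 * (2 * (2 * eps) ^+ 2).
  by apply: opnormM_le => //; exact: opnorm_isometry.
rewrite (le_trans (lerD h1 h2))//; lra.
Qed.

End eigenspaces.
End subspace.
End perturbation.

(** * Product rule for expectations of independent variables *)

Section independence.
Import HBNNSimple.
Context (d : measure_display) (T : measurableType d) (R : realType).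
Variable P : probability T R.

(** An identity known on the events generated by a random variable extends to
    the variable itself: by linearity to simple functions of [g], then by
    monotone convergence. *)
Lemma ge0_integral_mul_of_indic (X g : T -> R) (c : R) :
  0 <= c -> (forall w, 0 <= X w) -> (forall w, 0 <= g w) ->
  measurable_fun setT X -> measurable_fun setT g ->
  (forall B, measurable B -> (\int[P]_w (X w * \1_(g @^-1` B) w)%:E =
    c%:E * P (g @^-1` B))%E) ->
  (\int[P]_w (X w * g w)%:E = c%:E * \int[P]_w (g w)%:E)%E.
Proof.
move=> c0 X0 g0 mX mg h.
(* The approximants are simple functions of the value of [g], so that they
   only involve events generated by [g]; the absolute value makes the
   approximated function nonnegative on the whole line. *)
have mn : measurable_fun [set: R] (EFin \o (@Num.norm R R)).
  by apply/measurable_EFinP; exact: normr_measurable.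
pose phi := nnsfun_approx measurableT mn.
have phi_cvg y : (phi n y)%:E @[n --> \oo] --> `|y|%:E.
  apply: (cvg_nnsfun_approx measurableT mn) => // x _.
  by rewrite lee_fin normr_ge0.
have phi_cvgg w : (phi n (g w))%:E @[n --> \oo] --> (g w)%:E.
  by have := phi_cvg (g w); rewrite ger0_norm.
have phi_nd y : {homo (fun n => phi n y) : m n / (m <= n)%N >-> m <= n}.
  by move=> m n mn'; have /lefP := nd_nnsfun_approx measurableT mn mn'; exact.
have mphi n : measurable_fun setT (fun w => phi n (g w)).
  by apply: measurableT_comp => //; exact: measurable_funP.
have intphi n : (\int[P]_w (X w * phi n (g w))%:E =
    c%:E * \int[P]_w (phi n (g w))%:E)%E.
  have mind z : measurable_fun setT (\1_(g @^-1` (phi n @^-1` [set z])) : T -> R).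
    apply: measurable_indic; rewrite -[X in measurable X]setTI; exact: mg.
  have z0 z w : 0 <= z * \1_(g @^-1` (phi n @^-1` [set z])) w :> R.
    rewrite indicE; case: (boolP (_ \in _)) => [|_]; last by rewrite mulr0.
    by rewrite inE/= => <-; rewrite mulr1.
  have fin := fimfunP (phi n).
  transitivity (\int[P]_w (\sum_(z \in range (phi n))
      (X w * (z * \1_(g @^-1` (phi n @^-1` [set z])) w))%:E))%E.
    apply: eq_integral => w _; rewrite fimfunE fsbig_finite//= mulr_sumr.
    by rewrite fsbig_finite//= sumEFin.
  rewrite ge0_integral_fsum//; last 2 first.
  - move=> z; apply/measurable_EFinP; apply: measurable_funM => //.
    exact: measurable_funM.
  - by move=> z w _; rewrite lee_fin mulr_ge0.
  transitivity (c%:E * \int[P]_w (\sum_(z \in range (phi n))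
      (z * \1_(g @^-1` (phi n @^-1` [set z])) w)%:E))%E; last first.
    congr (_ * _)%E; apply: eq_integral => w _.
    by rewrite [in RHS]fimfunE !fsbig_finite//= sumEFin.
  rewrite ge0_integral_fsum//; last 2 first.
  - move=> z; apply/measurable_EFinP; exact: measurable_funM.
  - by move=> z w _; rewrite lee_fin.
  rewrite !fsbig_finite//= ge0_sume_distrr; last first.
    by move=> z _; apply: integral_ge0 => w _; rewrite lee_fin.
  rewrite big_seq [RHS]big_seq; apply: eq_bigr => z; rewrite in_fset_set// inE => -[y _ yz].
  have zge0 : 0 <= z by rewrite -yz.
  have mB : measurable (phi n @^-1` [set z]) by [].
  have mgB : measurable (g @^-1` (phi n @^-1` [set z])).
    by rewrite -[X in measurable X]setTI; exact: mg.
  transitivity (z%:E * (c%:E * P (g @^-1` (phi n @^-1` [set z]))))%E.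
    rewrite -h// -ge0_integralZl_EFin//; last 2 first.
    - by move=> w _; rewrite lee_fin mulr_ge0// indicE; case: (_ \in _).
    - by apply/measurable_EFinP; exact: measurable_funM.
    by apply: eq_integral => w _; rewrite -EFinM mulrCA.
  rewrite muleCA; congr (_ * _)%E.
  transitivity (z%:E * \int[P]_w (\1_(g @^-1` (phi n @^-1` [set z])) w)%:E)%E.
    by rewrite integral_indic// setIT.
  by rewrite -ge0_integralZl_EFin//; exact/measurable_EFinP.
have e1 : (\int[P]_w (X w * g w)%:E =
    limn (fun n => \int[P]_w (X w * phi n (g w))%:E))%E.
  rewrite -monotone_convergence//.
  - apply: eq_integral => w _; apply/esym/cvg_lim => //.
    under eq_fun do rewrite EFinM.
    by rewrite EFinM; apply: cvgeZl.
  - by move=> n; apply/measurable_EFinP; exact: measurable_funM.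
  - by move=> n w _; rewrite lee_fin mulr_ge0.
  - by move=> w _ m n mn'; rewrite lee_fin ler_wpM2l// phi_nd.
have e2 : (\int[P]_w (phi n (g w))%:E @[n --> \oo] --> \int[P]_w (g w)%:E)%E.
  have -> : (\int[P]_w (g w)%:E = \int[P]_w (limn (fun n => (phi n (g w))%:E)))%E.
    by apply: eq_integral => w _; apply/esym/cvg_lim.
  apply: cvg_monotone_convergence => //.
  - by move=> n; exact/measurable_EFinP.
  - by move=> n w _; rewrite lee_fin.
  - by move=> w _ m n mn'; rewrite lee_fin phi_nd.
rewrite e1; apply/cvg_lim => //.
under eq_fun do rewrite intphi.
exact: cvgeZl.
Qed.

(** Independence is the product rule for indicators.  The indicators are
    replaced by the functions [g i] one index at a time, the other factors being
    kept fixed. *)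
Lemma independent_integral_prod (I : finType) (F : I -> set_system T)
    (g : I -> T -> R) :
  independent_classes P F ->
  (forall i, F i setT) -> (forall i A, F i A -> measurable A) ->
  (forall i w, 0 <= g i w) -> (forall i, measurable_fun setT (g i)) ->
  (forall i B, measurable B -> F i (g i @^-1` B)) ->
  (forall i, \int[P]_w (g i w)%:E < +oo)%E ->
  (\int[P]_w (\prod_i g i w)%:E = \prod_i \int[P]_w (g i w)%:E)%E.
Proof.
move=> indep FT Fm g0 mg gF gfin.
(* The factors with index in [s] have already been replaced. *)
pose h (s : seq I) (A : I -> set T) i : T -> R :=
  if i \in s then g i else \1_(A i).
have h0 s A i w : 0 <= h s A i w.
  by rewrite /h; case: ifP => // _; rewrite indicE; case: (_ \in _).
have mh s A : (forall i, F i (A i)) -> forall i, measurable_fun setT (h s A i).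
  move=> FA i; rewrite /h; case: ifP => // _; apply: measurable_indic.
  exact: Fm (FA i).
have hfin s A : (forall i, F i (A i)) -> forall i,
    (\int[P]_w (h s A i w)%:E \is a fin_num)%E.
  move=> FA i; rewrite ge0_fin_numE; last first.
    by apply: integral_ge0 => w _; rewrite lee_fin.
  rewrite /h; case: ifP => // _; rewrite integral_indic// ?setIT; last exact: Fm (FA i).
  by rewrite (le_lt_trans (probability_le1 _ _))// ?ltry//; exact: Fm (FA i).
suff H s A : (forall i, F i (A i)) ->
    (\int[P]_w (\prod_i h s A i w)%:E = \prod_i \int[P]_w (h s A i w)%:E)%E.
  have := H (enum I) (fun=> setT) FT.
  have hE i : h (enum I) (fun=> setT) i = g i by rewrite /h mem_enum.
  by under eq_integral do under eq_bigr do rewrite hE; under eq_bigr do rewrite hE.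
elim: s A => [|j s IH] A FA.
  have hE i : h [::] A i = \1_(A i) by [].
  have mA i : measurable (A i) := Fm i _ (FA i).
  under [RHS]eq_bigr do rewrite hE integral_indic// setIT.
  have := indep [set: I]%SET A (fun i _ => FA i).
  rewrite [RHS](eq_bigl xpredT) => [<-|i]; last by rewrite finset.in_setT.
  set S := \bigcap_(i in _) _.
  have mS : measurable S by apply: fin_bigcap_measurable.
  rewrite -[in RHS](setIT S) -integral_indic//; apply: eq_integral => w _.
  congr (_%:E); rewrite [RHS]indicE; have [wS|wS] := pselect (S w).
    rewrite mem_set//; apply: big1 => i _; rewrite hE indicE mem_set//.
    by apply: wS; rewrite /= finset.in_setT.
  rewrite memNset//; have [i wAi] : exists i, ~ A i w.
    by apply: contra_notP wS => /forallNP wA i _; apply: contrapT; exact: wA.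
  by rewrite (bigD1 i)//= hE indicE memNset// mul0r.
have [js|js] := boolP (j \in s).
  have hE i : h (j :: s) A i = h s A i.
    by rewrite /h inE; case: eqVneq => // ->; rewrite js.
  under eq_integral do under eq_bigr do rewrite hE.
  by under [RHS]eq_bigr do rewrite hE; exact: IH.
pose c := (\prod_(i | i != j) fine (\int[P]_w (h s A i w)%:E)%E).
have cE : (\prod_(i | i != j) \int[P]_w (h s A i w)%:E = c%:E)%E.
  rewrite /c -prodEFin; apply: eq_bigr => i _; rewrite fineK//; exact: hfin.
have hj A' i : i != j -> h (j :: s) A' i = h s A' i.
  by move=> ij; rewrite /h inE (negbTE ij).
have hjj A' : h (j :: s) A' j = g j by rewrite /h mem_head.
pose X w := \prod_(i | i != j) h s A i w.
have -> : (\int[P]_w (\prod_i h (j :: s) A i w)%:E = \int[P]_w (X w * g j w)%:E)%E.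
  apply: eq_integral => w _; rewrite (bigD1 j)//= hjj mulrC; congr (_ * _)%:E.
  by apply: eq_bigr => i ij; rewrite hj.
rewrite (bigD1 j)//= hjj.
under eq_bigr => i ij do rewrite hj//.
rewrite cE muleC; apply: ge0_integral_mul_of_indic => //.
- by apply: prodr_ge0 => i _; apply: fine_ge0; apply: integral_ge0 => w _; rewrite lee_fin.
- by move=> w; apply: prodr_ge0.
- rewrite /X; under eq_fun do rewrite big_mkcond.
  apply: measurable_prod => i _; case: (i != j) => //; exact: mh.
move=> B mB.
pose A' i := if i == j then g j @^-1` B else A i.
have FA' i : F i (A' i).
  by rewrite /A'; case: eqVneq => [->|_]; [exact: gF|exact: FA].
have hA' i : i != j -> h s A' i = h s A i by move=> ij; rewrite /h /A' (negbTE ij).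
have hA'j : h s A' j = \1_(g j @^-1` B) by rewrite /h (negbTE js) /A' eqxx.
have := IH _ FA'; rewrite (bigD1 j)//= hA'j integral_indic//; last exact: Fm (gF _ _ mB).
rewrite setIT muleC.
under eq_bigr => i ij do rewrite hA'//.
rewrite cE => <-; apply: eq_integral => w _; rewrite [in RHS](bigD1 j)//= hA'j mulrC.
congr (_ * _)%:E; apply: eq_bigr => i ij; by rewrite hA'.
Qed.

End independence.

(** * Sub-Gaussian variables and their squares *)

Section exponential_inequalities.
Variable R : realType.

(** From [1 - x <= expR (- x)] one gets [expR x - 1 - x <= x * (expR x - 1)],
    whose right-hand side is of second order. *)
Lemma expR_le_quad (x : R) : expR x <= 1 + x + x ^+ 2 * expR `|x|.
Proof.
have h1 : 1 - x <= expR (- x) by rewrite expR_ge1Dx.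
have h2 : expR x * (1 - x) <= 1.
  by rewrite -[leRHS](expRxMexpNx_1 x) ler_wpM2l// expR_ge0.
have h3 : expR x - 1 - x <= x * (expR x - 1) by lra.
suff : x * (expR x - 1) <= x ^+ 2 * expR `|x| by lra.
have [x0|x0] := leP 0 x.
  rewrite ger0_norm// expr2 -mulrA ler_wpM2l//; lra.
rewrite ltr0_norm// expr2 -mulrA.
have e1 : 1 <= expR (- x) by rewrite (le_trans _ h1)//; lra.
rewrite ler_nM2l// (@le_trans _ _ x)//; first by rewrite ger_nMr.
have := expR_ge1Dx x; lra.
Qed.

Lemma sqr_le_expR (c y : R) : 0 < c -> 0 <= y ->
  y ^+ 2 <= (2 / c) ^+ 2 * expR (c * y).
Proof.
move=> c0 y0; have -> : expR (c * y) = expR (c * y / 2) ^+ 2.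
  by rewrite expr2 -expRD; congr expR; field.
have c2 : 0 <= 2 / c by rewrite divr_ge0// ltW.
rewrite -exprMn ler_sqr ?nnegrE ?(mulr_ge0 c2) ?expR_ge0//.
apply: (@le_trans _ _ (2 / c * (1 + c * y / 2))).
  by rewrite (_ : 2 / c * _ = 2 / c + y) ?lerDr//; field; rewrite gt_eqF.
by rewrite ler_wpM2l// expR_ge1Dx.
Qed.

Lemma expR_half_le2 : expR 2^-1 <= 2 :> R.
Proof.
have h := expRxMexpNx_1 (2^-1 : R); have e0 := expR_gt0 (2^-1 : R).
have : 2^-1 <= expR (- 2^-1) :> R.
  by rewrite (le_trans _ (expR_ge1Dx _))//; lra.
nra.
Qed.

Lemma ge2_expR1 : 2 <= expR 1 :> R.
Proof. by rewrite (le_trans _ (expR_ge1Dx _)). Qed.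

End exponential_inequalities.

Section subgaussian.
Context (d : measure_display) (T : measurableType d) (R : realType).
Variable P : probability T R.

Lemma integrable_dominated (f g : T -> R) :
  measurable_fun setT f -> measurable_fun setT g ->
  (forall w, `|f w| <= g w) -> (\int[P]_w (g w)%:E < +oo)%E ->
  P.-integrable setT (EFin \o f).
Proof.
move=> mf mg fg gfin.
apply: (@le_integrable _ _ _ _ _ _ _ (EFin \o g)) => //.
- exact/measurable_EFinP.
- by move=> w _; rewrite lee_fin (le_trans (fg w))// ler_norm.
apply/integrableP; split; first exact/measurable_EFinP.
rewrite (eq_integral (fun w => (g w)%:E))// => w _ /=.
by rewrite ger0_norm// (le_trans _ (fg w)).
Qed.

Lemma integral_cst1 (c : R) : (\int[P]_w c%:E = c%:E)%E.
Proof. by rewrite integral_cst//= probability_setT mule1. Qed.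

Lemma ge0_le_integral_R (f g : T -> R) : (forall w, 0 <= f w) ->
  measurable_fun setT f -> measurable_fun setT g -> (forall w, f w <= g w) ->
  (\int[P]_w (f w)%:E <= \int[P]_w (g w)%:E)%E.
Proof.
move=> f0 mf mg fg; apply: ge0_le_integral => //.
- by move=> w _; rewrite lee_fin.
- exact/measurable_EFinP.
- exact/measurable_EFinP.
- by move=> w _; rewrite lee_fin.
Qed.

Lemma ge0_integralZl_R (a : R) (f : T -> R) : 0 <= a -> (forall w, 0 <= f w) ->
  measurable_fun setT f ->
  (\int[P]_w (a * f w)%:E = a%:E * \int[P]_w (f w)%:E)%E.
Proof.
move=> a0 f0 mf; rewrite -ge0_integralZl_EFin//; first by move=> w _; rewrite lee_fin.
exact/measurable_EFinP.
Qed.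

Lemma integralD_R (f g : T -> R) :
  P.-integrable setT (EFin \o f) -> P.-integrable setT (EFin \o g) ->
  (\int[P]_w (f w + g w)%:E = \int[P]_w (f w)%:E + \int[P]_w (g w)%:E)%E.
Proof. by move=> fi gi; rewrite -integralD_EFin. Qed.

(** For a centred variable the linear term of [expR_le_quad] integrates to
    0. *)
Lemma expectation_expR_le (Z g : T -> R) (a C : R) :
  measurable_fun setT Z -> measurable_fun setT g ->
  (\int[P]_w (Z w)%:E = 0)%E -> P.-integrable setT (EFin \o Z) ->
  0 <= a -> (forall w, Z w ^+ 2 * expR `|Z w| <= a * g w) ->
  (forall w, 0 <= g w) -> (\int[P]_w (g w)%:E <= C%:E)%E ->
  (\int[P]_w (expR (Z w))%:E <= (expR (a * C))%:E)%E.
Proof.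
move=> mZ mg Z0 Zint a0 Zg g0 gC.
have gint : P.-integrable setT (EFin \o g).
  apply: (integrable_dominated mg mg) => [w|].
    by rewrite ger0_norm.
  by rewrite (le_lt_trans gC)// ltry.
pose h w := 1 + Z w + a * g w.
have h_ge w : expR (Z w) <= h w.
  by rewrite (le_trans (expR_le_quad _))// lerD2l.
have aint : P.-integrable setT (EFin \o (fun w => a * g w)).
  by apply: eq_integrable (integrableZl measurableT a gint) => // w _.
have cint : P.-integrable setT (EFin \o (fun _ : T => 1 : R)).
  apply: (@integrable_dominated _ (fun=> 1)) => // [w|].
    by rewrite normr1.
  by rewrite integral_cst1 ltry.
have czint : P.-integrable setT (EFin \o (fun w => 1 + Z w)).
  by apply: eq_integrable (integrableD measurableT cint Zint) => // w _.
have hE : (\int[P]_w (h w)%:E = 1 + a%:E * \int[P]_w (g w)%:E)%E.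
  rewrite (integralD_R czint aint) (integralD_R cint Zint) Z0 adde0 integral_cst1.
  by rewrite ge0_integralZl_R.
apply: (@le_trans _ _ (\int[P]_w (h w)%:E)%E).
  apply: ge0_le_integral_R => //; first exact: measurableT_comp.
  apply: measurable_funD; first exact: measurable_funD.
  exact: measurable_funM.
rewrite hE; apply: (@le_trans _ _ (1 + a%:E * C%:E)%E).
  by rewrite leeD2l// lee_wpmul2l// lee_fin.
by rewrite -EFinM -EFinD lee_fin expR_ge1Dx.
Qed.

(** The infimum defining the norm need not be attained, hence the radius
    [`|B| + 1], which also is positive for every [B]. *)
Lemma psi2_norm_expR (Y : T -> R) (B : R) : measurable_fun setT Y ->
  (psi2_norm P Y <= B%:E)%E ->
  (\int[P]_w (expR ((Y w / (`|B| + 1)) ^+ 2))%:E <= 2%:E)%E.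
Proof.
move=> mY YB; have B1 : B < `|B| + 1 by have := ler_norm B; lra.
have : (psi2_norm P Y < (`|B| + 1)%:E)%E by rewrite (le_lt_trans YB)// lte_fin.
move=> /ereal_inf_lt[_ [t [t0 +] <-]]; rewrite lte_fin unlock => tE tB.
apply: le_trans tE; apply: ge0_le_integral_R => //.
- apply: measurableT_comp => //.
  by apply: measurable_funX; apply: measurable_funM.
- apply: measurableT_comp => //.
  by apply: measurable_funM => //; exact: measurable_funX.
- move=> w; rewrite ler_expR expr_div_n ler_wpM2l ?sqr_ge0//.
  have K0 : 0 < `|B| + 1 by rewrite (lt_trans t0).
  rewrite lef_pV2 ?posrE ?exprn_gt0// ler_sqr ?nnegrE; lra.
Qed.

(** With [v = u * K]: for small [v] by the second-order bound for centred
    variables, and for large [v] from [v z <= v^2 / 4 + z^2], the constant factor 2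
    being absorbed by [expR (4 v^2)]. *)
Lemma subgaussian_mgf (Y : T -> R) (K u : R) : 0 < K -> measurable_fun setT Y ->
  (\int[P]_w (Y w)%:E = 0)%E ->
  (\int[P]_w (expR ((Y w / K) ^+ 2))%:E <= 2%:E)%E ->
  (\int[P]_w (expR (u * Y w))%:E <= (expR (16 * K ^+ 2 * u ^+ 2))%:E)%E.
Proof.
move=> K0 mY Y0 YK; pose g w := expR ((Y w / K) ^+ 2).
have mg : measurable_fun setT g.
  apply: measurableT_comp => //; apply: measurable_funX; exact: measurable_funM.
have g0 w : 0 <= g w by exact: expR_ge0.
have muY : measurable_fun setT (fun w => u * Y w) by exact: measurable_funM.
pose v := u * K; have uYE w : u * Y w = v * (Y w / K).
  by rewrite /v; field; rewrite gt_eqF.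
have -> : 16 * K ^+ 2 * u ^+ 2 = 16 * v ^+ 2 by rewrite /v; ring.
have gfin : (\int[P]_w (g w)%:E < +oo)%E by rewrite (le_lt_trans YK)// ltry.
have Yint : P.-integrable setT (EFin \o Y).
  apply: (@integrable_dominated _ (fun w => K * g w)) => //.
  - exact: measurable_funM.
  - move=> w; rewrite -{1}(divfK (lt0r_neq0 K0) (Y w)) normrM (gtr0_norm K0) mulrC.
    rewrite ler_pM2l// (le_trans _ (expR_ge1Dx _))// -[in leRHS]real_normK ?num_real//.
    move: (normr_ge0 (Y w / K)) => ?; nra.
  - rewrite ge0_integralZl_R ?ltW//.
    by rewrite lte_mul_pinfty ?lee_fin ?(ltW K0).
have [v1|v1] := leP `|v| 2^-1.
  rewrite (_ : 16 * v ^+ 2 = 8 * v ^+ 2 * 2); last by ring.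
  apply: (expectation_expR_le (g := g)) => //.
  - under eq_integral do rewrite EFinM.
    by rewrite integralZl// Y0 mule0.
  - by apply: eq_integrable (integrableZl measurableT u Yint) => // w _.
  - by rewrite mulr_ge0// sqr_ge0.
  - move=> w; rewrite uYE; set z := Y w / K.
    rewrite exprMn (_ : 8 * v ^+ 2 * g w = v ^+ 2 * (8 * g w)); last by ring.
    rewrite -[leLHS]mulrA.
    rewrite ler_wpM2l ?sqr_ge0//.
    have h1 : z ^+ 2 <= 4 * expR (z ^+ 2 / 4).
      have := expR_ge1Dx (z ^+ 2 / 4); lra.
    have h2 : expR `|v * z| <= 2 * expR (z ^+ 2 / 2).
      apply: (@le_trans _ _ (expR (2^-1 + z ^+ 2 / 2))).
        rewrite ler_expR normrM -(real_normK (num_real z)).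
        have := normr_ge0 z; move: (`|z|) => t t0.
        have : `|v| * t <= 2^-1 * t by rewrite ler_wpM2r.
        by have := sqr_ge0 (t - 1); nra.
      by rewrite expRD ler_wpM2r ?expR_ge0// expR_half_le2.
    apply: (@le_trans _ _ (4 * expR (z ^+ 2 / 4) * (2 * expR (z ^+ 2 / 2)))).
      by rewrite ler_pM ?sqr_ge0 ?expR_ge0.
    rewrite mulrACA -expRD (_ : 4 * 2 = 8); last by ring.
    rewrite ler_pM2l// /g -/z ler_expR; have := sqr_ge0 z; lra.
apply: (@le_trans _ _ (\int[P]_w (expR (v ^+ 2 / 4) * g w)%:E)%E).
  apply: ge0_le_integral_R => //; first exact: measurableT_comp.
  - exact: measurable_funM.
  - move=> w; rewrite /g -expRD ler_expR uYE.
    have := sqr_ge0 (v / 2 - Y w / K); nra.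
rewrite ge0_integralZl_R ?expR_ge0//.
apply: (@le_trans _ _ ((expR (v ^+ 2 / 4))%:E * 2%:E)%E).
  by rewrite lee_wpmul2l// lee_fin expR_ge0.
rewrite -EFinM lee_fin (le_trans (ler_wpM2l (expR_ge0 _) (@ge2_expR1 R)))//.
rewrite -expRD ler_expR.
have : (2^-1) ^+ 2 < `|v| ^+ 2 by rewrite ltr_sqr ?nnegrE// invr_ge0.
rewrite real_normK ?num_real//; lra.
Qed.

(** The square in the exponent is linearised by a sum over integer slopes in
    place of a Gaussian average: since [j x - j^2 / 2 = x^2 / 2 - (x - j)^2 / 2],
    the single term with [j] the integer part of [`|x|] suffices, up to the factor
    [expR (1 / 2) <= 2]. *)
Lemma expR_sqr_le_series (x : R) :
  ((expR (x ^+ 2 / 2))%:E <= \sum_(j <oo)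
    (2 * (expR (- (j%:R ^+ 2 / 2)) * (expR (j%:R * x) + expR (- j%:R * x))))%:E)%E.
Proof.
pose u j : R := 2 * (expR (- (j%:R ^+ 2 / 2)) * (expR (j%:R * x) + expR (- j%:R * x))).
have u0 j : 0 <= u j by rewrite !mulr_ge0 ?addr_ge0 ?expR_ge0.
pose j := Num.trunc `|x|.
have /andP[j1 j2] : j%:R <= `|x| < j.+1%:R.
  by rewrite Num.Theory.trunc_itv.
apply: (@le_trans _ _ (u j)%:E); last first.
  rewrite (le_trans _ (@nneseries_lim_ge _ (fun j => (u j)%:E) xpredT 0 j.+1 _))//.
    rewrite big_nat_recr//= leeDr//; apply: sume_ge0 => i _; exact: u0.
  by move=> i _ _; rewrite lee_fin.
rewrite lee_fin /u.
have h : expR (j%:R * `|x|) <= expR (j%:R * x) + expR (- j%:R * x).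
  have [x0|x0] := leP 0 x; first by rewrite ger0_norm// lerDl expR_ge0.
  by rewrite ltr0_norm// mulrN mulNr lerDr expR_ge0.
apply: (@le_trans _ _ (expR 2^-1 * (expR (- (j%:R ^+ 2 / 2)) * expR (j%:R * `|x|)))).
  rewrite -!expRD ler_expR -[in leLHS](real_normK (num_real x)).
  have : (`|x| - j%:R) ^+ 2 <= 1.
    rewrite expr_le1 ?subr_ge0// lerBlDr -natr1 in j2 *.
    by rewrite addrC ltW.
  nra.
apply: ler_pM; rewrite ?expR_ge0 ?mulr_ge0 ?expR_ge0//.
  exact: expR_half_le2.
by rewrite ler_wpM2l ?expR_ge0.
Qed.

(** Integrating the series over integer slopes term by term leaves
    [4 * expR (- j^2 / 4)], dominated by a geometric series of ratio 4/5. *)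
Lemma expR_sqr_integral (Z : T -> R) : measurable_fun setT Z ->
  (forall u, \int[P]_w (expR (u * Z w))%:E <= (expR (u ^+ 2 / 4))%:E)%E ->
  (\int[P]_w (expR (Z w ^+ 2 / 2))%:E <= 20%:E)%E.
Proof.
move=> mZ hZ.
pose f j w : R := 2 * (expR (- (j%:R ^+ 2 / 2)) *
  (expR (j%:R * Z w) + expR (- j%:R * Z w))).
have f0 j w : 0 <= f j w by rewrite !mulr_ge0 ?addr_ge0 ?expR_ge0.
have me (u : R) : measurable_fun setT (fun w => expR (u * Z w)).
  by apply: measurableT_comp => //; exact: measurable_funM.
have mf j : measurable_fun setT (f j).
  apply: measurable_funM => //; apply: measurable_funM => //.
  exact: measurable_funD.
have fj j : (\int[P]_w (f j w)%:E <= (4 * (4 / 5) ^+ j)%:E)%E.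
  rewrite /f; under eq_integral do rewrite mulrA.
  rewrite ge0_integralZl_R ?mulr_ge0 ?expR_ge0//; last exact: measurable_funD.
  under eq_integral do rewrite EFinD.
  rewrite ge0_integralD//; [|exact/measurable_EFinP..].
  apply: (@le_trans _ _ ((2 * expR (- (j%:R ^+ 2 / 2)))%:E *
      ((expR (j%:R ^+ 2 / 4))%:E + (expR (j%:R ^+ 2 / 4))%:E))%E).
    rewrite lee_wpmul2l ?lee_fin ?mulr_ge0 ?expR_ge0// leeD//.
    by rewrite (le_trans (hZ _))// sqrrN.
  rewrite -EFinD -EFinM lee_fin.
  have -> (a b : R) : 2 * a * (b + b) = 4 * (a * b) by ring.
  rewrite -expRD ler_pM2l// (_ : _ + _ = - (j%:R ^+ 2 / 4)); last by field.
  rewrite (_ : 4 / 5 = (5 / 4)^-1); last by rewrite invf_div.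
  rewrite exprVn expRN lef_pV2 ?posrE ?expR_gt0 ?exprn_gt0//.
  apply: (@le_trans _ _ (expR (4^-1) ^+ j)).
    by rewrite lerXn2r ?nnegrE ?expR_ge0// (le_trans _ (expR_ge1Dx _))//; lra.
  rewrite -expRM_natl ler_expR -mulr_natl.
  have : (j%:R : R) <= j%:R ^+ 2.
    by rewrite -natrX ler_nat; case: (j) => // i; rewrite -[X in (X <= _)%N]expn1 leq_pexp2l.
  lra.
apply: (@le_trans _ _ (\int[P]_w (\sum_(j <oo) (f j w)%:E))%E).
  apply: ge0_le_integral => //.
  - apply/measurable_EFinP; apply: measurableT_comp => //.
    by apply: measurable_funM => //; exact: measurable_funX.
  - apply: ge0_emeasurable_sum; first by move=> j w _ _; rewrite lee_fin.
    by move=> j _; exact/measurable_EFinP.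
  - by move=> w _; exact: expR_sqr_le_series.
rewrite integral_nneseries//; last 2 first.
- by move=> j; exact/measurable_EFinP.
- by move=> j w _; rewrite lee_fin.
apply: lime_le.
  by apply: is_cvg_nneseries => j _ _; apply: integral_ge0 => w _; rewrite lee_fin.
apply: nearW => N; apply: (@le_trans _ _ (\sum_(0 <= j < N) (4 * (4 / 5) ^+ j)%:E)%E).
  by apply: lee_sum => j _.
rewrite sumEFin lee_fin.
suff -> : \sum_(0 <= j < N) (4 * (4 / 5) ^+ j) = 20 * (1 - (4 / 5) ^+ N) :> R.
  by rewrite ler_piMr// gerBl exprn_ge0.
elim: N => [|N IH]; first by rewrite big_nil expr0 subrr mulr0.
by rewrite big_nat_recr//= IH exprS; field.
Qed.

End subgaussian.

(** * Bernstein inequality for sums of centred squares *)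

Section sigma_of.
Context (d : measure_display) (T : measurableType d) (R : realType).

Lemma sigma_of_setT (J : Type) (Z : J -> T -> R) : sigma_of Z setT.
Proof.
have [h0 h1 _] := smallest_sigma_algebra setT
  (\bigcup_j preimage_set_system setT (Z j) measurable).
by have := h1 _ h0; rewrite setD0.
Qed.

Lemma sigma_of_measurable (J : Type) (Z : J -> T -> R) :
  (forall j, measurable_fun setT (Z j)) ->
  forall A, sigma_of Z A -> measurable A.
Proof.
move=> mZ; apply: smallest_sub; first exact: sigma_algebra_measurable.
by move=> A [j _ [B mB <-]]; exact: mZ.
Qed.

Lemma sigma_of_comp (J : Type) (Z : J -> T -> R) (g : T -> R) :
  measurable_fun setT (g : g_sigma_algebraType
    (\bigcup_j preimage_set_system setT (Z j) measurable) -> R) ->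
  forall B, measurable B -> sigma_of Z (g @^-1` B).
Proof. by move=> mg B mB; have := mg measurableT B mB; rewrite setTI. Qed.

Lemma sigma_of_gen (J : Type) (Z : J -> T -> R) j :
  measurable_fun setT (Z j : g_sigma_algebraType
    (\bigcup_j preimage_set_system setT (Z j) measurable) -> R).
Proof.
move=> _ B mB; apply: sub_sigma_algebra; exists j => //; exists B => //.
Qed.

End sigma_of.

Section bernstein.
Context (d : measure_display) (T : measurableType d) (R : realType).
Variable P : probability T R.

(** Locked, because unification would otherwise unfold the numeral. *)
Definition bernstein_const : R := locked (5120 * expR 10).

Lemma bernstein_const_ge : 4 <= bernstein_const.
Proof. by have := expR_ge1Dx (10 : R); rewrite /bernstein_const -lock; lra. Qed.

(** The square has exponential moments, so the second-order exponential bound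
    applies to its centred version, as it does to a sub-Gaussian variable. *)
Lemma centered_square_mgf (Z : T -> R) (m lambda : R) : measurable_fun setT Z ->
  (forall u, \int[P]_w (expR (u * Z w))%:E <= (expR (u ^+ 2 / 4))%:E)%E ->
  (\int[P]_w (Z w ^+ 2)%:E = m%:E)%E -> `|lambda| <= 8^-1 ->
  (\int[P]_w (expR (lambda * (Z w ^+ 2 - m)))%:E <=
    (expR (bernstein_const * lambda ^+ 2))%:E)%E.
Proof.
move=> mZ hZ mE l8; pose g w := expR (Z w ^+ 2 / 2).
have mZ2 : measurable_fun setT (fun w => Z w ^+ 2) by exact: measurable_funX.
have mg : measurable_fun setT g.
  by apply: measurableT_comp => //; exact: measurable_funM.
have g0 w : 0 <= g w by exact: expR_ge0.
have g20 : (\int[P]_w (g w)%:E <= 20%:E)%E by exact: expR_sqr_integral.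
have Z2g w : Z w ^+ 2 <= 2 * g w.
  by have := expR_ge1Dx (Z w ^+ 2 / 2); rewrite /g; lra.
have m0 : 0 <= m.
  by rewrite -lee_fin -mE; apply: integral_ge0 => w _; rewrite lee_fin sqr_ge0.
have m40 : m <= 40.
  rewrite -lee_fin -mE; apply: (@le_trans _ _ (\int[P]_w (2 * g w)%:E)%E).
    by apply: ge0_le_integral_R => // [w|]; [exact: sqr_ge0|exact: measurable_funM].
  rewrite ge0_integralZl_R// (_ : 40 = 2 * 20); last by ring.
  by rewrite EFinM lee_wpmul2l.
have Zint : P.-integrable setT (EFin \o (fun w => Z w ^+ 2)).
  apply: (@integrable_dominated _ _ _ _ _ (fun w => 2 * g w)) => //.
  - exact: measurable_funM.
  - by move=> w; rewrite ger0_norm ?sqr_ge0.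
  - by rewrite ge0_integralZl_R// (le_lt_trans (lee_wpmul2l _ g20))// -EFinM ltry.
have cint : P.-integrable setT (EFin \o (fun _ : T => - m)).
  apply: (@integrable_dominated _ _ _ _ _ (fun=> m)) => // [w|].
    by rewrite normrN ger0_norm.
  by rewrite integral_cst1 ltry.
have Yint : P.-integrable setT (EFin \o (fun w => Z w ^+ 2 - m)).
  by apply: eq_integrable (integrableD measurableT Zint cint) => // w _.
rewrite (_ : _ * _ ^+ 2 = 256 * expR 10 * lambda ^+ 2 * 20); last first.
  by rewrite /bernstein_const -lock; ring.
apply: (expectation_expR_le (g := g)) => //.
- by apply: measurable_funM => //; exact: measurable_funB.
- under eq_integral do rewrite EFinM.
  rewrite integralZl// (integralD_R Zint cint) mE integral_cst1.
  by rewrite -EFinD subrr mule0.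
- by apply: eq_integrable (integrableZl measurableT lambda Yint) => // w _.
- exact: mulr_ge0 (mulr_ge0 (ler0n _ _) (expR_ge0 _)) (sqr_ge0 _).
move=> w; set z := Z w; set y := z ^+ 2 + m.
have y0 : 0 <= y by rewrite addr_ge0 ?sqr_ge0.
have zy : `|z ^+ 2 - m| <= y.
  by rewrite (le_trans (ler_normB _ _))// ger0_norm ?sqr_ge0// ger0_norm.
have h1 : (lambda * (z ^+ 2 - m)) ^+ 2 <= lambda ^+ 2 * (256 * expR (8^-1 * y)).
  rewrite exprMn ler_wpM2l ?sqr_ge0//.
  rewrite (@le_trans _ _ (y ^+ 2))//.
    by rewrite -real_normK ?num_real// ler_sqr ?nnegrE.
  have := @sqr_le_expR R 8^-1 y _ y0; rewrite invrK (_ : (2 * 8) ^+ 2 = 256); last by ring.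
  by apply; rewrite invr_gt0.
have h2 : expR `|lambda * (z ^+ 2 - m)| <= expR (8^-1 * y).
  by rewrite ler_expR normrM ler_pM.
apply: (le_trans (ler_pM (sqr_ge0 _) (expR_ge0 _) h1 h2)).
rewrite (_ : 256 * expR 10 * lambda ^+ 2 * g w =
  lambda ^+ 2 * (256 * (expR 10 * g w))); last by ring.
rewrite -[leLHS]mulrA -[X in _ * X <= _]mulrA -expRD.
rewrite ler_wpM2l ?sqr_ge0// ler_pM2l// /g -expRD ler_expR -/z /y.
have := sqr_ge0 z; lra.
Qed.

(** Markov's inequality for [expR S]. *)
Lemma markov_expR (S : T -> R) (c : R) : measurable_fun setT S ->
  (P [set w | (c <= S w)%R] <= (expR (- c))%:E * \int[P]_w (expR (S w))%:E)%E.
Proof.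
move=> mS; set A := [set w | _].
have mA : measurable A.
  by have := mS measurableT _ (measurable_itv `[c, +oo[); rewrite setTI set_itvE.
have me : measurable_fun setT (fun w => expR (S w)) by exact: measurableT_comp.
rewrite -ge0_integralZl_R ?expR_ge0//.
rewrite -[in leLHS](setIT A) -integral_indic//.
apply: ge0_le_integral_R.
- by move=> w; rewrite indicE; case: (_ \in _).
- exact: measurable_indic.
- exact: measurable_funM.
move=> w; rewrite indicE; have [wA|wA] := pselect (A w).
  by rewrite mem_set// -expRD -expR0 ler_expR addrC subr_ge0.
by rewrite memNset// mulr_ge0 ?expR_ge0.
Qed.

(** Bernstein's inequality for sums of centred squares; the sign of [lambda]
    selects the tail. *)
Lemma sum_centered_square_tail (n : nat) (F : 'I_n -> set_system T)
    (Z : 'I_n -> T -> R) (m t lambda : R) :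
  independent_classes P F -> (forall i, F i setT) ->
  (forall i A, F i A -> measurable A) ->
  (forall i, measurable_fun setT (Z i)) ->
  (forall i (f : R -> R), measurable_fun setT f -> forall B, measurable B ->
    F i ((fun w => f (Z i w)) @^-1` B)) ->
  (forall i u, \int[P]_w (expR (u * Z i w))%:E <= (expR (u ^+ 2 / 4))%:E)%E ->
  (forall i, \int[P]_w (Z i w ^+ 2)%:E = m%:E)%E -> `|lambda| <= 8^-1 ->
  (P [set w | (t <= lambda * \sum_i (Z i w ^+ 2 - m))%R] <=
    (expR (n%:R * (bernstein_const * lambda ^+ 2) - t))%:E)%E.
Proof.
move=> indep FT Fm mZ ZF hZ mE l8.
have mf : measurable_fun [set: R] (fun x => expR (lambda * (x ^+ 2 - m))).
  apply: measurableT_comp => //; apply: measurable_funM => //.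
  by apply: measurable_funB => //; exact: measurable_funX.
have mSi i : measurable_fun setT (fun w => Z i w ^+ 2 - m).
  by apply: measurable_funB => //; exact: measurable_funX.
have hi i := centered_square_mgf (mZ i) (hZ i) (mE i) l8.
apply: (le_trans (markov_expR _ _)).
  by apply: measurable_funM => //; exact: measurable_sum.
rewrite addrC expRD EFinM lee_wpmul2l ?lee_fin ?expR_ge0//.
under eq_integral => w _ do
  rewrite mulr_sumr (big_morph _ (@expRD R) (@expR0 R)).
rewrite (independent_integral_prod indep FT Fm)//; last 3 first.
- by move=> i; apply: (measurableT_comp mf).
- by move=> i B mB; exact: (ZF i _ mf B mB).
- by move=> i; rewrite (le_lt_trans (hi i))// ltry.
have -> : expR (n%:R * (bernstein_const * lambda ^+ 2)) =
    \prod_(i < n) expR (bernstein_const * lambda ^+ 2).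
  by rewrite prodr_const card_ord -expRM_natl.
rewrite -prodEFin.
suff /andP[] : (0 <= \prod_i \int[P]_w (expR (lambda * (Z i w ^+ 2 - m)))%:E <=
  \prod_(i < n) (expR (bernstein_const * lambda ^+ 2))%:E)%E by [].
elim/big_ind2 : _ => [|x1 x2 y1 y2 /andP[h1 h2] /andP[h3 h4]|i _].
- by rewrite lee01 lexx.
- by rewrite mule_ge0//= lee_pmul.
by rewrite hi andbT; apply: integral_ge0 => w _; rewrite lee_fin expR_ge0.
Qed.

End bernstein.

(** * Quadratic forms of the sample covariance matrix *)

Section linear_model.
Context (d : measure_display) (T : measurableType d) (R : realType).
Variable P : probability T R.
Variables (n p : nat) (B : R).
Variables (Sigma half : 'M[R]_p) (X : 'I_n -> T -> 'cV[R]_p)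
  (Y : 'I_n -> 'I_p -> {RV P >-> R}).
Hypotheses (halfP : is_psd_sqrt Sigma half)
  (XE : forall i w, X i w = half *m \col_j Y i j w)
  (X_mean : forall i j, ('E_P[(fun w => X i w j 0%R)] = 0)%E)
  (X_cov : forall i a b, covariance P (fun w => X i w a 0)
     (fun w => X i w b 0) = (Sigma a b)%:E)
  (Y_vec : independent_vectors P (fun i j => Y i j : T -> R))
  (Y_coord : forall i, independent_RVs P (fun j => Y i j : T -> R))
  (Y_law : forall i j, [/\ ('E_P[Y i j] = 0)%E, ('V_P[Y i j] = 1)%E
      & (psi2_norm P (Y i j) <= B%:E)%E]).

Let K := `|B| + 1.

Local Lemma K_gt0 : 0 < K. Proof. by rewrite ltr_wpDl. Qed.

Local Lemma measurable_Y i j : measurable_fun setT (Y i j : T -> R).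
Proof. exact: measurable_funP. Qed.

(** A linear form of a sample is a linear combination of the independent
    coordinates with coefficient vector [half *m v]. *)
Lemma dot_sampleE v i w : dot v (X i w) = \sum_j (half *m v) j 0 * Y i j w.
Proof.
have [hs _ _] := halfP.
by rewrite XE -{1}hs -dotMl dotE; apply: eq_bigr => j _; rewrite [X in _ * X]mxE.
Qed.

Lemma measurable_dot_sample v i : measurable_fun setT (fun w => dot v (X i w)).
Proof.
under eq_fun do rewrite dot_sampleE.
by apply: measurable_sum => j; exact: measurable_funM.
Qed.

Lemma dot_half v : dot (half *m v) (half *m v) = dot v (Sigma *m v).
Proof. by have [hs _ <-] := halfP; rewrite dotMl hs mulmxA. Qed.

Lemma dot_sample_mgf v i u : (\int[P]_w (expR (u * dot v (X i w)))%:E <=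
  (expR (16 * K ^+ 2 * u ^+ 2 * dot v (Sigma *m v)))%:E)%E.
Proof.
under eq_integral => w _ do
  rewrite dot_sampleE mulr_sumr (big_morph _ (@expRD R) (@expR0 R)).
have Yi j : (\int[P]_w (expR (u * ((half *m v) j 0 * Y i j w)))%:E <=
    (expR (16 * K ^+ 2 * (u * (half *m v) j 0) ^+ 2))%:E)%E.
  under eq_integral do rewrite mulrA.
  have [Y0 _ YB] := Y_law i j.
  apply: subgaussian_mgf => //; first exact: K_gt0.
    by rewrite -Y0 unlock.
  exact: psi2_norm_expR.
rewrite (independent_integral_prod (F := fun j => sigma_of (fun _ : unit => Y i j : T -> R))).
- rewrite -dot_half dotE mulr_sumr (big_morph _ (@expRD R) (@expR0 R)) -prodEFin.
  suff /andP[] : (0 <= \prod_j \int[P]_w (expR (u * ((half *m v) j 0 * Y i j w)))%:E <=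
    \prod_j (expR (16 * K ^+ 2 * u ^+ 2 * ((half *m v) j 0 * (half *m v) j 0)))%:E)%E by [].
  elim/big_ind2 : _ => [|x1 x2 y1 y2 /andP[h1 h2] /andP[h3 h4]|j _].
  - by rewrite lee01 lexx.
  - by rewrite mule_ge0//= lee_pmul.
  rewrite integral_ge0/= => [|w _]; last by rewrite lee_fin expR_ge0.
  by rewrite (le_trans (Yi j))// lee_fin ler_expR le_eqVlt; apply/orP; left; apply/eqP; ring.
- exact: Y_coord.
- by move=> j; exact: sigma_of_setT.
- by move=> j; apply: sigma_of_measurable => _; exact: measurable_Y.
- by move=> j w; exact: expR_ge0.
- by move=> j; apply: measurableT_comp => //; apply: measurable_funM => //; exact: measurable_funM.
- move=> j; apply: sigma_of_comp; apply: measurableT_comp => //.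
  apply: measurable_funM => //; apply: measurable_funM => //.
  exact: (sigma_of_gen (Z := fun _ : unit => Y i j : T -> R) tt).
- by move=> j; rewrite (le_lt_trans (Yi j))// ltry.
Qed.

Lemma measurable_sample i a : measurable_fun setT (fun w => X i w a 0).
Proof.
have -> : (fun w => X i w a 0) = (fun w => \sum_j half a j * Y i j w).
  by apply/funext => w; rewrite XE mxE; apply: eq_bigr => j _; rewrite mxE.
by apply: measurable_sum => j; exact: measurable_funM.
Qed.

Lemma sample_cross_moment i a b :
  (\int[P]_w (X i w a 0 * X i w b 0)%:E = (Sigma a b)%:E)%E.
Proof.
rewrite -(X_cov i) unlock !X_mean/= unlock; apply: eq_integral => w _ /=.
by rewrite !fctE/= !subr0.
Qed.

(** The diagonal moments are finite because they are given by [Sigma]. *)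
Lemma sample_cross_integrable i a b :
  P.-integrable setT (EFin \o (fun w => X i w a 0 * X i w b 0)).
Proof.
have mX2 c : measurable_fun setT (fun w => X i w c 0 * X i w c 0).
  by apply: measurable_funM; exact: measurable_sample.
apply: (@integrable_dominated _ _ _ _ _
  (fun w => X i w a 0 * X i w a 0 + X i w b 0 * X i w b 0)).
- by apply: measurable_funM; exact: measurable_sample.
- exact: measurable_funD.
- move=> w; move: (X i w a 0) (X i w b 0) => x y.
  by rewrite ler_norml; apply/andP; split;
    have := sqr_ge0 (x + y); have := sqr_ge0 (x - y); have := sqr_ge0 x;
    have := sqr_ge0 y; nra.
under eq_integral do rewrite EFinD.
rewrite ge0_integralD//.
- by rewrite !sample_cross_moment -EFinD ltry.
- by move=> w _; rewrite lee_fin -expr2 sqr_ge0.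
- exact/measurable_EFinP.
- by move=> w _; rewrite lee_fin -expr2 sqr_ge0.
- exact/measurable_EFinP.
Qed.

Lemma dot_sample_sq v i :
  (\int[P]_w (dot v (X i w) ^+ 2)%:E = (dot v (Sigma *m v))%:E)%E.
Proof.
transitivity (\int[P]_w (\sum_a \sum_b
    (v a 0 * v b 0)%:E * (X i w a 0 * X i w b 0)%:E))%E.
  apply: eq_integral => w _; rewrite dotE expr2 mulr_suml -sumEFin.
  apply: eq_bigr => a _; rewrite mulr_sumr -sumEFin; apply: eq_bigr => b _.
  by rewrite -EFinM; congr (_%:E); ring.
have hint a b : P.-integrable setT
    (fun w => (v a 0 * v b 0)%:E * (X i w a 0 * X i w b 0)%:E)%E.
  exact: (integrableZl measurableT (v a 0 * v b 0) (sample_cross_integrable i a b)).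
rewrite integral_sum//; last by move=> a; apply: integrable_sum.
rewrite dotE -sumEFin; apply: eq_bigr => a _.
rewrite integral_sum// mxE mulr_sumr -sumEFin; apply: eq_bigr => b _.
rewrite integralZl//; last exact: sample_cross_integrable.
by rewrite sample_cross_moment -EFinM; congr (_%:E); ring.
Qed.

Lemma dot_sample_cov v w : (0 < n)%N ->
  dot v ((sample_cov (fun i => X i w) - Sigma) *m v) =
  n%:R^-1 * \sum_i (dot v (X i w) ^+ 2 - dot v (Sigma *m v)).
Proof.
move=> n0; have n0' : n%:R != 0 :> R by rewrite pnatr_eq0 -lt0n.
rewrite mulmxBl dotDr dotNr sumrB sumr_const card_ord mulrBr -[dot v _ *+ n]mulr_natl.
rewrite mulKf//; congr (_ - _).
rewrite /sample_cov -scalemxAl dotZr mulmx_suml; congr (_ * _).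
rewrite /dot mulmx_sumr summxE; apply: eq_bigr => i _.
rewrite -(mulmxA (X i w)) mulmxA [LHS]mxE big_ord1 expr2; congr (_ * _).
by rewrite -[LHS]/(dot (X i w) v) dotC.
Qed.

Lemma measurable_dot_sample_cov v : (0 < n)%N -> measurable_fun setT (fun w =>
  dot v ((sample_cov (fun i => X i w) - Sigma) *m v)).
Proof.
move=> n0; under eq_fun do rewrite dot_sample_cov//.
apply: measurable_funM => //; apply: measurable_sum => i.
apply: measurable_funB => //; apply: measurable_funX.
exact: measurable_dot_sample.
Qed.

(** The deviation is an average of centred squares of the [<v, X_i>], whose
    moment generating function is at most [expR (u^2 / 4)] after division by
    [b = sqrt (64 K^2 q)].  Bernstein's inequality is used with the optimal slope
    [l = t / (2 M)], where [M] is its constant; [t <= 1] keeps [l] in the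
    admissible range. *)
Lemma quad_form_deviation v q t : (0 < n)%N -> 0 < q ->
  dot v (Sigma *m v) <= q -> 0 <= t <= 1 ->
  (P [set w | (64 * K ^+ 2 * q * t <=
      `|dot v ((sample_cov (fun i => X i w) - Sigma) *m v)|)%R] <=
   (2 * expR (- (n%:R * t ^+ 2 / (4 * bernstein_const R))))%:E)%E.
Proof.
move=> n0 q0 vq /andP[t0 t1].
have nR : 0 < n%:R :> R by rewrite ltr0n.
have M4 := bernstein_const_ge R.
set M := bernstein_const R in M4 *.
have M0 : 0 < M by rewrite (lt_le_trans _ M4).
pose s := dot v (Sigma *m v).
have s0 : 0 <= s by rewrite /s -dot_half dot_ge0.
pose b2 := 64 * K ^+ 2 * q.
have b20 : 0 < b2 := mulr_gt0 (mulr_gt0 (ltr0Sn _ _) (exprn_gt0 _ K_gt0)) q0.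
pose b := Num.sqrt b2.
have b0 : 0 < b by rewrite sqrtr_gt0.
have bb : b ^+ 2 = b2 by rewrite sqr_sqrtr// ltW.
pose Z (i : 'I_n) w := b^-1 * dot v (X i w).
have mZ i : measurable_fun setT (Z i).
  by apply: measurable_funM => //; exact: measurable_dot_sample.
have hZ i u : (\int[P]_w (expR (u * Z i w))%:E <= (expR (u ^+ 2 / 4))%:E)%E.
  rewrite /Z; under eq_integral do rewrite mulrA.
  rewrite (le_trans (dot_sample_mgf v i (u * b^-1)))// lee_fin ler_expR.
  rewrite exprMn exprVn bb -/s.
  have -> : 16 * K ^+ 2 * (u ^+ 2 / b2) * s = u ^+ 2 / 4 * (s / q).
    rewrite /b2; field.
    by rewrite (lt0r_neq0 q0) (lt0r_neq0 K_gt0).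
  by rewrite ler_piMr ?divr_ge0 ?sqr_ge0// ler_pdivrMr// mul1r.
have mE i : (\int[P]_w (Z i w ^+ 2)%:E = (s / b2)%:E)%E.
  rewrite /Z; under eq_integral do rewrite exprMn exprVn bb.
  rewrite ge0_integralZl_R ?invr_ge0 ?ltW//.
  - by rewrite dot_sample_sq -EFinM mulrC.
  - by move=> w; exact: sqr_ge0.
  - by apply: measurable_funX; exact: measurable_dot_sample.
pose S w := \sum_i (Z i w ^+ 2 - s / b2).
have SE w : dot v ((sample_cov (fun i => X i w) - Sigma) *m v) =
    n%:R^-1 * b2 * S w.
  rewrite dot_sample_cov// -mulrA; congr (_ * _).
  rewrite mulr_sumr; apply: eq_bigr => i _.
  by rewrite /Z exprMn exprVn bb -/s; field; rewrite gt_eqF.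
have mS : measurable_fun setT S.
  apply: measurable_sum => i; apply: measurable_funB => //.
  exact: measurable_funX.
pose l := t / (2 * M).
have l0 : 0 <= l by rewrite divr_ge0// mulr_ge0// ltW.
have l8 : l <= 8^-1.
  rewrite /l ler_pdivrMr ?mulr_gt0// (le_trans t1)//.
  by move: M4; lra.
have tail la : `|la| = l ->
    (P [set w | (n%:R * t * l <= la * S w)%R] <=
    (expR (- (n%:R * t ^+ 2 / (4 * M))))%:E)%E.
  move=> la_l; rewrite (@le_trans _ _ (expR (n%:R * (M * la ^+ 2) - n%:R * t * l))%:E)//.
    apply: (sum_centered_square_tail (F := fun i => sigma_of (fun j => Y i j : T -> R))) => //.
    - by move=> i; exact: sigma_of_setT.
    - by move=> i; apply: sigma_of_measurable => j; exact: measurable_Y.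
    - move=> i f mf C mC.
      apply: (sigma_of_comp (g := fun w => f (Z i w))) => //.
      apply: (measurableT_comp mf).
      have -> : Z i = (fun w => b^-1 * \sum_j (half *m v) j 0 * Y i j w).
        by apply/funext => w; rewrite /Z dot_sampleE.
      apply: measurable_funM => //.
      apply: measurable_sum => j; apply: measurable_funM => //.
      exact: (sigma_of_gen (Z := fun j => Y i j : T -> R) j).
    - by rewrite la_l.
  rewrite lee_fin ler_expR -(real_normK (num_real la)) la_l /l.
  rewrite le_eqVlt; apply/orP; left; apply/eqP; field.
  by rewrite gt_eqF.
have mtail la : measurable [set w | (n%:R * t * l <= la * S w)%R].
  have mlS : measurable_fun setT (fun w => la * S w) by exact: measurable_funM.
  have := mlS measurableT _ (measurable_itv `[n%:R * t * l, +oo[).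
  by rewrite setTI set_itvE.
apply: (@le_trans _ _ (P ([set w | (n%:R * t * l <= l * S w)%R] `|`
     [set w | (n%:R * t * l <= - l * S w)%R]))).
  apply: le_measure; rewrite ?inE.
  - have mf := measurable_dot_sample_cov v n0.
    have mn : measurable_fun setT (fun w =>
        `|dot v ((sample_cov (fun i => X i w) - Sigma) *m v)| : R).
      exact: measurableT_comp.
    have := mn measurableT _ (measurable_itv `[64 * K ^+ 2 * q * t, +oo[).
    by rewrite setTI set_itvE.
  - exact: measurableU.
  have nb : 0 <= n%:R^-1 * b2 by rewrite mulr_ge0 ?invr_ge0 ?ltW.
  move=> w /=; rewrite SE -/b2 normrM (ger0_norm nb).
  rewrite (mulrC n%:R^-1) -(mulrA b2) ler_pM2l// ler_pdivlMl// => h.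
  have := ler_wpM2r l0 h; case: (ger0P (S w)) => S0 hl; [left|right].
    by rewrite (mulrC l).
  by rewrite mulNr -mulrN (mulrC l).
apply: (le_trans (measureU2 _ _ _)) => //.
rewrite mulr2n mulrDl mul1r EFinD leeD// tail// ?normrN ger0_norm//.
Qed.

End linear_model.

(** * Discretising the unit sphere *)

Section net.
Variable R : realType.

(** The grid of mesh [1 / N] in the cube of side 2: its cardinality
    [(2 N + 1)^m] has logarithm of order [m log N]. *)
Definition grid_point m N (z : {ffun 'I_m -> 'I_N.*2.+1}) : 'cV[R]_m :=
  \col_i (((z i)%:R - N%:R) / N%:R).

(** Rounding each coordinate down costs at most [1 / N], hence at most
    [sqrt m / N <= 1 / 8] in norm. *)
Lemma grid_point_near m N (x : 'cV[R]_m) : (64 * m <= N ^ 2)%N -> (0 < N)%N ->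
  vnorm x <= 1 -> exists z, vnorm (x - grid_point (N := N) z) <= 8^-1.
Proof.
move=> mN N0 x1.
have NR : 0 < N%:R :> R by rewrite ltr0n.
have xi i : `|x i 0| <= 1.
  rewrite -(@expr_le1 _ 2)// real_normK ?num_real//.
  rewrite (@le_trans _ _ (dot x x))//; last by rewrite -sqr_vnorm expr_le1// vnorm_ge0.
  by rewrite dotE (bigD1 i)//= -expr2 lerDl sumr_ge0// => j _; rewrite -expr2 sqr_ge0.
pose y i := (x i 0 + 1) * N%:R.
have y0 i : 0 <= y i.
  by rewrite mulr_ge0// -lerBlDr sub0r; have := xi i; rewrite ler_norml => /andP[].
have yN i : (Num.trunc (y i) < N.*2.+1)%N.
  rewrite ltnS -(ler_nat R) (le_trans (_ : _ <= y i))//.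
    by have /andP[] := Num.Theory.trunc_itv (y0 i).
  rewrite /y -muln2 natrM (mulrC N%:R) ler_pM2r//.
  by have := xi i; rewrite ler_norml => /andP[_]; lra.
exists [ffun i => Ordinal (yN i)].
apply: vnorm_le_sqr; first by rewrite invr_ge0.
apply: (@le_trans _ _ (\sum_(i < m) N%:R ^- 2)).
  rewrite dotE; apply: ler_sum => i _; rewrite -expr2 !mxE ffunE /=.
  have /andP[h1 h2] := Num.Theory.trunc_itv (y0 i).
  set t := (Num.trunc _)%:R in h1 *.
  have -> : x i 0 - (t - N%:R) / N%:R = (y i - t) / N%:R.
    by rewrite /y; field; rewrite gt_eqF.
  rewrite exprMn exprVn ler_piMl ?invr_ge0 ?exprn_ge0 ?(ltW NR)//.
  rewrite expr_le1 ?subr_ge0// lerBlDr ltW// (lt_le_trans h2)//.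
  by rewrite -natr1 addrC.
rewrite sumr_const card_ord -[leLHS]mulr_natl ler_pdivrMr ?exprn_gt0//.
rewrite -natrX -(ler_pM2l (_ : 0 < 64))// mulrA.
have -> : 64 * 8^-1 ^+ 2 = 1 :> R by field.
by rewrite mul1r -natrM ler_nat.
Qed.

(** Moving from a unit vector to a grid point changes the quadratic form by a
    fraction [17 / 64] of the norm that is being estimated, which is absorbed. *)
Lemma opnorm_le_grid m N (E : 'M[R]_m) t : (64 * m <= N ^ 2)%N -> (0 < N)%N ->
  E^T = E -> 0 <= t ->
  (forall z, vnorm (grid_point (N := N) z) <= 2 ->
    `|dot (grid_point z) (E *m grid_point z)| <= t) ->
  opnorm E <= 2 * t.
Proof.
move=> mN N0 Es t0 h; have E0 := opnorm_ge0 E.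
suff : opnorm E <= t + 17 / 64 * opnorm E by lra.
apply: opnorm_sym => // [|x x1]; first by rewrite addr_ge0// mulr_ge0.
have [z zx] := grid_point_near mN N0 x1.
set v := grid_point z in zx *.
have v98 : vnorm v <= 9 / 8.
  rewrite (_ : v = x - (x - v)); last by rewrite opprB addrC subrK.
  by rewrite (le_trans (vnormB _ _))//; lra.
have -> : dot x (E *m x) = dot v (E *m v) + dot (x - v) (E *m (x + v)).
  rewrite mulmxDr !(dotDl, dotDr, dotNl, dotNr).
  have -> : dot v (E *m x) = dot x (E *m v) by rewrite -{1}Es -dotMl dotC.
  by ring.
rewrite (le_trans (ler_normD _ _))// lerD//; first by apply: h; lra.
rewrite (le_trans (cauchy_schwarz _ _))//.
have xv : vnorm (x + v) <= 17 / 8 by rewrite (le_trans (vnormD _ _))//; lra.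
have Exv : vnorm (E *m (x + v)) <= opnorm E * (17 / 8).
  by rewrite (le_trans (opnormP _ _))// ler_wpM2l.
apply: (le_trans (ler_pM (vnorm_ge0 _) (vnorm_ge0 _) zx Exv)).
by rewrite le_eqVlt; apply/orP; left; apply/eqP; field.
Qed.

End net.

(** * Restriction to the support *)

Section embedding.
Variables (R : realType) (p : nat) (J : {set 'I_p}).

(** The inclusion of the coordinates in [J]; conjugating with it restricts a
    matrix to its principal submatrix. *)
Definition emb_mx : 'M[R]_(p, #|J|) := \matrix_(i, a) (i == enum_val a)%:R.

Lemma mul_tr_emb_mx k (M : 'M[R]_(p, k)) a b :
  (emb_mx^T *m M) a b = M (enum_val a) b.
Proof.
rewrite mxE (bigD1 (enum_val a))//= big1 => [|i ia].
  by rewrite !mxE eqxx mul1r addr0.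
by rewrite !mxE (negbTE ia) mul0r.
Qed.

Lemma mul_mx_emb_mx k (M : 'M[R]_(k, p)) a b :
  (M *m emb_mx) a b = M a (enum_val b).
Proof.
by rewrite -[M *m _]trmxK trmx_mul mxE mul_tr_emb_mx mxE.
Qed.

Lemma principal_submxE (M : 'M[R]_p) :
  principal_submx J M = emb_mx^T *m M *m emb_mx.
Proof. by apply/matrixP => a b; rewrite mul_mx_emb_mx mul_tr_emb_mx mxE. Qed.

Lemma emb_mx_isometry : emb_mx^T *m emb_mx = 1%:M.
Proof.
by apply/matrixP => a b; rewrite mul_tr_emb_mx !mxE (inj_eq enum_val_inj).
Qed.

Lemma emb_mx_restrict k (M : 'M[R]_(p, k)) :
  (forall i, i \notin J -> row i M = 0) -> emb_mx *m (emb_mx^T *m M) = M.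
Proof.
move=> M0; apply/matrixP => i b; have [iJ|iJ] := boolP (i \in J); last first.
  have /rowP/(_ b) := M0 _ iJ; rewrite mxE => ->; rewrite !mxE big1// => a _.
  rewrite mxE; case: eqP => [ia|_]; last by rewrite mul0r.
  by move: iJ; rewrite ia enum_valP.
rewrite mxE (bigD1 (enum_rank_in iJ i))//= big1 => [|a ia].
  by rewrite mul_tr_emb_mx enum_rankK_in// mxE enum_rankK_in// eqxx mul1r addr0.
rewrite mxE; case: eqP => [ia'|_]; last by rewrite mul0r.
by case/eqP: ia; apply: enum_val_inj; rewrite enum_rankK_in.
Qed.

Lemma row_emb_mx k (M : 'M[R]_(#|J|, k)) i :
  row_norm (row i (emb_mx *m M)) = 0 \/
  exists a, row i (emb_mx *m M) = row a M.
Proof.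
have [iJ|iJ] := boolP (i \in J); last first.
  left; rewrite row_norm_vnorm (_ : (row i _)^T = 0) ?vnorm0//.
  apply/colP => b; rewrite !mxE big1// => a _; rewrite mxE.
  case: eqP => [ia|_]; last by rewrite mul0r.
  by move: iJ; rewrite ia enum_valP.
right; exists (enum_rank_in iJ i); apply/rowP => b; rewrite !mxE.
rewrite (bigD1 (enum_rank_in iJ i))//= big1 => [|a ia].
  by rewrite mxE enum_rankK_in// eqxx mul1r addr0.
rewrite mxE; case: eqP => [ia'|_]; last by rewrite mul0r.
by case/eqP: ia; apply: enum_val_inj; rewrite enum_rankK_in.
Qed.

Lemma refit_outputE k (Sh : 'M[R]_p) (Ut : 'M[R]_(p, k)) :
  refit_output Sh J Ut -> exists2 V : 'M[R]_(#|J|, k),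
    leading_eigenvectors (principal_submx J Sh) V & Ut = emb_mx *m V.
Proof.
move=> [V [VP Vrow V0]]; exists V => //; rewrite -(emb_mx_restrict V0).
congr (_ *m _); apply/matrixP => a b; rewrite mul_tr_emb_mx.
by have /rowP/(_ b) := Vrow a; rewrite !mxE.
Qed.

End embedding.

Lemma norm2inf_le (R : realType) p k (M : 'M[R]_(p, k)) c : 0 <= c ->
  (forall i, row_norm (row i M) <= c) -> norm2inf M <= c.
Proof. by move=> c0 h; apply/bigmax_leP; split. Qed.

Lemma norm2inf_ge0 (R : realType) p k (M : 'M[R]_(p, k)) : 0 <= norm2inf M.
Proof. exact: bigmax_ge_id. Qed.

Section refit.
Variable R : realType.

(** The variant for matrices whose eigenvalues may be negative, with indices
    restricted to the dimension. *)
Lemma eigval_nonincreasing_in m (M : 'M[R]_m) lam i j : is_spectrum M lam ->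
  (0 < i <= j)%N -> (j <= m)%N -> eigval lam j <= eigval lam i.
Proof.
move=> [slam clam] /andP[i0 ij] jm.
have sz : size lam = m.
  have := size_char_poly M; rewrite clam size_prod_XsubC => -[]//.
have tr : transitive (>=%R : rel R) by move=> a b e /= ab be; exact: le_trans be ab.
apply: (sorted_leq_nth tr (fun x => lexx x) 0 slam); rewrite ?inE ?sz.
- by case: (i) i0 ij jm => // i' _ /= ij jm; rewrite (leq_trans ij).
- by case: (j) (leq_trans i0 ij) jm.
- by case: (i) (j) i0 ij => [|?] [|?].
Qed.

Lemma isometry_leq m k (Q : 'M[R]_(m, k)) : Q^T *m Q = 1%:M -> (k <= m)%N.
Proof.
move=> QQ; have := mxrankM_maxr Q^T Q; rewrite QQ mxrank1 => /leq_trans; apply.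
exact: rank_leq_row.
Qed.

Lemma vnorm_col_isometry m k (Q : 'M[R]_(m, k)) j :
  Q^T *m Q = 1%:M -> vnorm (col j Q) = 1.
Proof. by move=> QQ; rewrite colE vnorm_isometry// /vnorm dot_deltal mxE !eqxx sqrtr1. Qed.

Variables (p k : nat) (Sigma : 'M[R]_p) (lam : seq R) (U : 'M[R]_(p, k))
  (J : {set 'I_p}).
Hypotheses (k0 : (0 < k)%N) (Ss : Sigma^T = Sigma)
  (psd : forall v, 0 <= dot v (Sigma *m v))
  (lamP : is_spectrum Sigma lam)
  (lam0 : {in lam, forall x, 0 <= x})
  (gap : eigval lam k.+1 < eigval lam k)
  (eU : eigenvectors_for Sigma lam U)
  (UJ0 : forall i, i \notin J -> row i U = 0).
Let lk := eigval lam k.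
Let mu := eigval lam k.+1.
Let e : 'M[R]_(p, #|J|) := emb_mx R J.
Let UJ := e^T *m U.
Let S := principal_submx J Sigma.

(** The deterministic vectors whose bilinear forms with the columns of [UJ] are
    the entries of the first-order term, rescaled by the gap to have norm at
    most 1. *)
Definition probe_vector i (j : 'I_k) : 'cV[R]_(#|J|) :=
  (lk - mu) *: (perp_proj UJ *m
    reduced_resolvent S UJ (top_diag k lam 0 j) *m delta_mx i 0).

Lemma eigval_tail_ge0 : 0 <= mu.
Proof.
rewrite /mu /eigval /=; have [h|h] := ltnP k (size lam).
  by apply: lam0; exact: mem_nth.
by rewrite nth_default.
Qed.

Lemma emb_restrict_U : e *m UJ = U.
Proof. exact: emb_mx_restrict. Qed.

Lemma restrict_U_isometry : UJ^T *m UJ = 1%:M.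
Proof.
suff : (e *m UJ)^T *m (e *m UJ) = 1%:M.
  by rewrite trmx_mul -mulmxA (mulmxA e^T) emb_mx_isometry mul1mx.
by rewrite emb_restrict_U; case: eU.
Qed.

Lemma principal_submx_sym (M : 'M[R]_p) : M^T = M ->
  (principal_submx J M)^T = principal_submx J M.
Proof. by move=> Ms; rewrite principal_submxE !trmx_mul trmxK Ms mulmxA. Qed.

Lemma restrict_eigen : S *m UJ = UJ *m diag_mx (top_diag k lam).
Proof.
rewrite /S principal_submxE -/e -(mulmxA _ e UJ) emb_restrict_U -mulmxA.
by rewrite (eigenvectors_forE eU) mulmxA.
Qed.

Lemma dot_principal_submx (M : 'M[R]_p) v :
  dot v (principal_submx J M *m v) = dot (e *m v) (M *m (e *m v)).
Proof. by rewrite principal_submxE -!mulmxA -dotMl. Qed.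

(** A vector of the block orthogonal to [UJ] extends by zeros to a vector
    orthogonal to [U]. *)
Lemma restrict_perp v : UJ^T *m v = 0 ->
  0 <= dot v (S *m v) <= mu * dot v v.
Proof.
move=> Uv; rewrite dot_principal_submx psd/=.
rewrite -(dot_isometry v v (emb_mx_isometry R J)).
apply: (dot_tail_le Ss lamP lam0 eU) => //.
by rewrite -Uv /UJ trmx_mul trmxK mulmxA.
Qed.

Lemma mu_lt_lk : 0 <= mu < lk. Proof. by rewrite eigval_tail_ge0. Qed.

Lemma vnorm_probe_vector i j : vnorm (probe_vector i j) <= 1.
Proof.
have /andP[m0 ml] := mu_lt_lk.
have g0 : 0 < lk - mu by rewrite subr_gt0.
rewrite vnormZ gtr0_norm// mulrC -ler_pdivlMr// div1r.
rewrite (le_trans (opnormP _ _))//.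
have -> : vnorm (delta_mx i 0 : 'cV[R]_#|J|) = 1.
  by rewrite /vnorm dot_deltal mxE !eqxx sqrtr1.
rewrite mulr1; apply: (opnorm_reduced_resolvent (principal_submx_sym Ss)
  restrict_U_isometry mu_lt_lk restrict_perp).
exact: (top_diag_ge lamP lam0).
Qed.

(** The deterministic core: the sampling error enters only through its quadratic
    form at finitely many fixed vectors.  Grid points control its operator norm,
    and sums and differences of probe vectors and eigenvectors control, by
    polarisation, the first-order term. *)
Theorem refit_row_bound (Sh : 'M[R]_p) (Ut : 'M[R]_(p, k)) (tau1 tau2 : R) :
  Sh^T = Sh -> refit_output Sh J Ut ->
  (64 * #|J| <= p ^ 2)%N -> (0 < p)%N -> 0 <= tau1 -> 0 <= tau2 ->
  (forall z, vnorm (grid_point R (N := p) z) <= 2 ->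
    `|dot (e *m grid_point R (N := p) z) ((Sh - Sigma) *m (e *m grid_point R z))| <= tau1) ->
  (forall i j (b : bool), let v := e *m (probe_vector i j + (-1) ^+ b *: col j UJ) in
    `|dot v ((Sh - Sigma) *m v)| <= tau2) ->
  2 * tau1 <= (lk - mu) / 8 ->
  exists2 W, orthogonal_mx W & norm2inf (Ut - U *m W) <=
    Num.sqrt k%:R * (tau2 / (2 * (lk - mu))) + 18 * (2 * tau1 / (lk - mu)) ^+ 2.
Proof.
move=> Shs /refit_outputE[V [lam' lamP' eV] UtE] Jp p0 t10 t20 h1 h2 small.
have /andP[m0 ml] := mu_lt_lk.
have g0 : 0 < lk - mu by rewrite subr_gt0.
pose E := principal_submx J Sh - S.
have EE : E = principal_submx J (Sh - Sigma).
  by rewrite /E /S !principal_submxE mulmxBr mulmxBl.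
have Es : E^T = E.
  by rewrite EE principal_submx_sym// linearB/= Shs Ss.
have VV : V^T *m V = 1%:M by case: eV.
have Eop : opnorm E <= 2 * tau1.
  apply: (opnorm_le_grid Jp) => // z z2.
  by rewrite EE dot_principal_submx; exact: h1.
have SE : S + E = principal_submx J Sh by rewrite /E addrC subrK.
have Eq v : dot v (E *m v) = dot (e *m v) ((Sh - Sigma) *m (e *m v)).
  by rewrite EE dot_principal_submx.
have Shs' : (principal_submx J Sh)^T = principal_submx J Sh by exact: principal_submx_sym.
(* Weyl's inequality, by testing the perturbed form on the range of [UJ]. *)
have tk : lk - 2 * tau1 <= eigval lam' k.
  apply: (eigval_ge_of_form k0 Shs' lamP' restrict_U_isometry) => y.
  rewrite -SE (mulmxDl S) dotDr (mulmxA S) restrict_eigen -(mulmxA UJ).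
  rewrite dot_isometry ?restrict_U_isometry// dot_diag_mx mulrBl lerD//.
    rewrite dotE mulr_sumr; apply: ler_sum => l _.
    by rewrite -expr2 ler_wpM2r ?sqr_ge0// (top_diag_ge lamP lam0).
  rewrite lerNl (le_trans _ (_ : 2 * tau1 * (vnorm y * vnorm y) <= _))//; last first.
    by rewrite -expr2 sqr_vnorm.
  rewrite (le_trans (ler_norm _))// normrN (le_trans (cauchy_schwarz _ _))//.
  rewrite (vnorm_isometry _ restrict_U_isometry) mulrCA ler_wpM2l ?vnorm_ge0//.
  have := opnorm_mulmxP (UJ *m y) Eop.
  by rewrite (vnorm_isometry _ restrict_U_isometry).
pose eps := 2 * tau1 / (lk - mu).
have epsE : eps * (lk - mu) = 2 * tau1 by rewrite divfK// gt_eqF.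
have beta i j : `|dot (perp_proj UJ *m reduced_resolvent S UJ (top_diag k lam 0 j)
    *m delta_mx i 0) (E *m col j UJ)| <= tau2 / (2 * (lk - mu)).
  set a := _ *m delta_mx i 0; set u := col j UJ.
  have hp : `|dot (probe_vector i j + u) (E *m (probe_vector i j + u))| <= tau2.
    by rewrite Eq; have := h2 i j false; rewrite expr0 scale1r.
  have hm : `|dot (probe_vector i j - u) (E *m (probe_vector i j - u))| <= tau2.
    by rewrite Eq; have := h2 i j true; rewrite expr1 scaleN1r.
  have su : dot u (E *m probe_vector i j) = dot (probe_vector i j) (E *m u).
    by rewrite -{1}Es -dotMl dotC.
  have pe : (lk - mu) * dot a (E *m u) = dot (probe_vector i j) (E *m u).
    by rewrite /probe_vector dotZl.
  rewrite ler_pdivlMr ?mulr_gt0// -(gtr0_norm g0) -(gtr0_norm (ltr0Sn R 1)) -!normrM.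
  rewrite mulrC -mulrA pe.
  have -> : 2 * dot (probe_vector i j) (E *m u) =
      (dot (probe_vector i j + u) (E *m (probe_vector i j + u))
       - dot (probe_vector i j - u) (E *m (probe_vector i j - u))) / 2.
    by rewrite mulmxDr mulmxBr !(dotDl, dotDr, dotNl, dotNr) su; field.
  rewrite normrM (ger0_norm (_ : 0 <= 2^-1))//.
  have := ler_normB (dot (probe_vector i j + u) (E *m (probe_vector i j + u)))
    (dot (probe_vector i j - u) (E *m (probe_vector i j - u))).
  lra.
have Sres : S^T = S by exact: principal_submx_sym.
have l_ge j : lk <= top_diag k lam 0 j by exact: (top_diag_ge lamP lam0).
have Eop' : opnorm E <= eps * (lk - mu) by rewrite epsE.
have SEV : (S + E) *m V = V *m diag_mx (top_diag k lam').
  by rewrite SE (eigenvectors_forE eV).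
have t_ge j : lk - eps * (lk - mu) <= top_diag k lam' 0 j.
  rewrite epsE (le_trans tk)// mxE; apply: (eigval_nonincreasing_in lamP').
    by rewrite /= ltn_ord.
  exact: isometry_leq VV.
have eps8 : eps <= 8^-1 by rewrite /eps ler_pdivrMr// [_ * (lk - mu)]mulrC.
have [W WW HW] := eigenspace_row_perturbation Sres restrict_U_isometry restrict_eigen
  l_ge mu_lt_lk restrict_perp Eop' VV SEV t_ge eps8 beta.
have b0 : 0 <= Num.sqrt k%:R * (tau2 / (2 * (lk - mu))) + 18 * eps ^+ 2.
  rewrite addr_ge0 ?(mulr_ge0 _ (sqr_ge0 _))// mulr_ge0 ?sqrtr_ge0// divr_ge0//.
  by rewrite mulr_ge0// ltW.
exists W => //; apply: norm2inf_le => // i.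
have -> : Ut - U *m W = e *m (V - UJ *m W).
  by rewrite mulmxBr mulmxA emb_restrict_U UtE.
have [->|[a ->]] := row_emb_mx (V - UJ *m W) i; last exact: HW.
exact: b0.
Qed.

Lemma refit_trivial_bound (Sh : 'M[R]_p) (Ut : 'M[R]_(p, k)) :
  refit_output Sh J Ut ->
  exists2 W, orthogonal_mx W & norm2inf (Ut - U *m W) <= 2.
Proof.
move=> /refit_outputE[V [lam' _ [VV _]] ->]; have [UU _] := eU.
exists 1%:M; first by rewrite /orthogonal_mx trmx1 mulmx1.
rewrite mulmx1; apply: norm2inf_le => // i.
rewrite linearB/= (le_trans (row_normB _ _))// (_ : 2 = 1 * 1 + 1); last by ring.
apply: lerD; rewrite (le_trans (row_norm_le_opnorm _ _))// ?opnorm_isometry//.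
by apply: opnormM_le; apply: opnorm_isometry => //; exact: emb_mx_isometry.
Qed.

End refit.

(** * Probability of the exceptional events *)

Section events.
Context (d : measure_display) (T : measurableType d) (R : realType).
Variable P : probability T R.

Lemma finite_union_bound (I : finType) (A : I -> set T) (c : R) :
  (forall i, measurable (A i)) -> (forall i, P (A i) <= c%:E)%E ->
  exists N, [/\ measurable N, forall i, A i `<=` N & (P N <= (#|I|%:R * c)%:E)%E].
Proof.
move=> mA Ac.
have [N [mN AN PN]] : exists N, [/\ measurable N, forall i, i \in enum I -> A i `<=` N
    & (P N <= ((size (enum I))%:R * c)%:E)%E].
  elim: (enum I) => [|i r [N [mN AN PN]]].
    by exists set0; split => //; rewrite measure0 mul0r.
  exists (A i `|` N); split; first exact: measurableU.
    move=> j; rewrite inE => /orP[/eqP->|jr]; first exact: subsetUl.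
    by apply: subset_trans (AN _ jr) _; exact: subsetUr.
  apply: (le_trans (measureU2 _ (mA i) mN)).
  by rewrite /= -natr1 mulrDl mul1r addrC EFinD leeD.
exists N; split => // [i|]; first by apply: AN; rewrite mem_enum.
by rewrite cardE.
Qed.

Lemma measure_setD_ge (A N : set T) (a c : R) : measurable A -> measurable N ->
  (a%:E <= P A)%E -> (P N <= c%:E)%E -> ((a - c)%:E <= P (A `\` N))%E.
Proof.
move=> mA mN aA Nc; have mD := measurableD mA mN.
have h : (P A <= P (A `\` N) + P N)%E.
  apply: (@le_trans _ _ (P ((A `\` N) `|` N))); last exact: measureU2.
  apply: le_measure; rewrite ?inE//; first exact: measurableU.
  by move=> w Aw; have [Nw|Nw] := pselect (N w); [right|left].
rewrite EFinB leeBlDr//.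
by rewrite (le_trans aA)// (le_trans h)// leeD2l.
Qed.

End events.

Section tail_sums.
Variable R : realType.

(** Turns Gaussian tails at level [sqrt (log p)] into powers of [p]. *)
Lemma expRN_ln (x y : R) (j : nat) : 0 < y -> x = j%:R * ln y ->
  expR (- x) = y^-1 ^+ j.
Proof.
move=> y0 ->; rewrite expRN expRM_natl lnK ?posrE//.
by rewrite exprVn.
Qed.

(** The grid has at most [p^(3 s)] points, against a tail of [p^(-10 s)]. *)
Lemma grid_tail_small (p m s : nat) : (64 <= p)%N -> (m <= s)%N -> (0 < s)%N ->
  ((p.*2.+1 ^ m)%:R * (2 * p%:R^-1 ^+ (10 * s)) : R) <= p%:R ^- 2 / 2.
Proof.
move=> p64 ms s0.
have p0 : 0 < p%:R :> R by rewrite ltr0n (leq_trans _ p64).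
set r := p%:R^-1; have r0 : 0 < r by rewrite invr_gt0.
have r64 : r <= 64^-1 by rewrite lef_pV2 ?posrE// ler_nat.
have r1 : r <= 1 by rewrite (le_trans r64)// invf_le1// ler1n.
have r0' := ltW r0.
have h1 : (p.*2.+1 ^ m)%:R * r ^+ (3 * s) <= 1.
  rewrite exprVn ler_pdivrMr ?exprn_gt0// mul1r -natrX ler_nat.
  rewrite expnM (@leq_trans (p.*2.+1 ^ s))//.
    by apply: leq_pexp2l.
  rewrite leq_exp2r// !expnS expn0 muln1.
  have h4 : (4 <= p * p)%N by rewrite (@leq_trans (64 * 64))// leq_mul.
  rewrite (@leq_trans (p * 4))// ?leq_mul// -addnn (mulnDr p 2 2) muln2 -addnn.
  by rewrite -addn1 leq_add2l (leq_trans _ (leq_addr _ _))// (leq_trans _ p64).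
have h2 : r ^+ (7 * s) <= r ^+ 7.
  by apply: ler_wiXn2l => //; rewrite -[X in (X <= _)%N]muln1 leq_mul.
rewrite (_ : 10 * s = 3 * s + 7 * s)%N; last by rewrite -mulnDl.
rewrite exprD mulrCA -exprVn -/r.
have h3 : (p.*2.+1 ^ m)%:R * r ^+ (3 * s) * r ^+ (7 * s) <= 1 * r ^+ 7.
  apply: ler_pM => //; rewrite ?mulr_ge0 ?exprn_ge0//.
have h4 : r ^+ 7 = r ^+ 2 * r ^+ 5 by rewrite -exprD.
have h5 : r ^+ 5 <= 4^-1.
  rewrite (le_trans (_ : _ <= r ^+ 1))//.
    exact: ler_wiXn2l.
  by rewrite expr1 (le_trans r64)// lef_pV2 ?posrE// ler_nat.
have h6 : r ^+ 2 * r ^+ 5 <= r ^+ 2 * 4^-1 by rewrite ler_wpM2l ?sqr_ge0.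
rewrite mul1r h4 in h3; have h7 := le_trans h3 h6.
rewrite (_ : r ^+ 2 / 2 = 2 * (r ^+ 2 * 4^-1)); last by field.
by rewrite ler_pM2l// -[leLHS]mulrA in h7 *.
Qed.

(** There are at most [2 p^2] probes, against a tail of [p^(-10)]. *)
Lemma probe_tail_small (p m k : nat) : (64 <= p)%N -> (m <= p)%N -> (k <= p)%N ->
  ((m * k * 2)%:R * (2 * p%:R^-1 ^+ 10) : R) <= p%:R ^- 2 / 2.
Proof.
move=> p64 mp kp.
have p0 : 0 < p%:R :> R by rewrite ltr0n (leq_trans _ p64).
set r := p%:R^-1; have r0 : 0 < r by rewrite invr_gt0.
have r64 : r <= 64^-1 by rewrite lef_pV2 ?posrE// ler_nat.
have r1 : r <= 1 by rewrite (le_trans r64)// invf_le1// ler1n.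
have r0' := ltW r0.
have h1 : (m * k * 2)%:R * r ^+ 2 <= 2.
  rewrite exprVn ler_pdivrMr ?exprn_gt0// -natrX -natrM ler_nat mulnC.
  by rewrite leq_mul2l /= -mulnn leq_mul.
have h2 : r ^+ 6 <= 64^-1.
  rewrite (le_trans (_ : _ <= r ^+ 1))//.
  exact: ler_wiXn2l.
have -> : r ^+ 10 = r ^+ 2 * r ^+ 6 * r ^+ 2 by rewrite -!exprD.
rewrite -exprVn -/r.
have h3 : (m * k * 2)%:R * r ^+ 2 * r ^+ 6 <= 2 * 64^-1.
  by apply: ler_pM => //; rewrite ?mulr_ge0 ?exprn_ge0.
have h4 : (m * k * 2)%:R * r ^+ 2 * r ^+ 6 * r ^+ 2 <= 2 * 64^-1 * r ^+ 2.
  by rewrite ler_wpM2r ?sqr_ge0.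
rewrite mulrCA (_ : r ^+ 2 / 2 = 2 * (r ^+ 2 * 4^-1)); last by field.
rewrite ler_pM2l// mulrA (mulrA _ (r ^+ 2) (r ^+ 6)) (le_trans h4)// mulrC.
by rewrite ler_wpM2l ?sqr_ge0//; lra.
Qed.

End tail_sums.

(** * Rate of the refitted estimator *)

(** The two summands bound the first-order term and the quadratic remainder;
    the latter carries a factor 8 because it must also exceed the trivial bound
    2 when the perturbation is not small. *)
Definition refit_const (R : realType) (B : R) : R :=
  let K := `|B| + 1 in let A := 40 * bernstein_const R in
  256 * K ^+ 2 * Num.sqrt A + 8 * (36 * (512 * K ^+ 2) ^+ 2 * A).

Section refit_rate.
Context (d : measure_display) (T : measurableType d) (R : realType).
Variable P : probability T R.
Variables (n p s k : nat) (B delta : R).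
Variables (Sigma half : 'M[R]_p) (lam : seq R) (U : 'M[R]_(p, k))
  (J : {set 'I_p}) (X : 'I_n -> T -> 'cV[R]_p)
  (Y : 'I_n -> 'I_p -> {RV P >-> R}) (Jhat : T -> {set 'I_p})
  (Ut : T -> 'M[R]_(p, k)).
Hypotheses (n0 : (0 < n)%N) (s0 : (0 < s)%N) (k0 : (0 < k)%N)
  (halfP : is_psd_sqrt Sigma half)
  (XE : forall i w, X i w = half *m \col_j Y i j w)
  (X_mean : forall i j, ('E_P[(fun w => X i w j 0%R)] = 0)%E)
  (X_cov : forall i a b, covariance P (fun w => X i w a 0)
     (fun w => X i w b 0) = (Sigma a b)%:E)
  (Y_vec : independent_vectors P (fun i j => Y i j : T -> R))
  (Y_coord : forall i, independent_RVs P (fun j => Y i j : T -> R))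
  (Y_law : forall i j, [/\ ('E_P[Y i j] = 0)%E, ('V_P[Y i j] = 1)%E
      & (psi2_norm P (Y i j) <= B%:E)%E])
  (lamP : is_spectrum Sigma lam) (lam0 : {in lam, forall x, 0 <= x})
  (gap : eigval lam k.+1 < eigval lam k)
  (half_gap : 2 * eigval lam k.+1 <= eigval lam k)
  (eU : eigenvectors_for Sigma lam U)
  (Js : (#|J| <= s)%N) (UJ0 : forall i, i \notin J -> row i U = 0)
  (mJhat : measurable [set w | Jhat w = J])
  (Jhat_prob : ((1 - delta)%:E <= P [set w | Jhat w = J])%E)
  (refit : forall w, (k <= #|Jhat w|)%N ->
    refit_output (sample_cov (fun i => X i w)) (Jhat w) (Ut w))
  (p64 : (64 <= p)%N)
  (small : 40 * bernstein_const R * (s%:R * ln p%:R / n%:R) <= 1).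

Let l1 := eigval lam 1.
Let lk := eigval lam k.
Let mu := eigval lam k.+1.
Let K := `|B| + 1.
Let A := 40 * bernstein_const R.

Local Lemma A_gt0 : 0 < A.
Proof. by rewrite mulr_gt0// (lt_le_trans _ (bernstein_const_ge R)). Qed.

Local Lemma lk_gt0 : 0 < lk.
Proof. exact: le_lt_trans (eigval_tail_ge0 k lam0) gap. Qed.

Local Lemma lk_le_l1 : lk <= l1.
Proof.
by case: lamP => slam _; apply: eigval_nonincreasing => //; rewrite k0.
Qed.

Local Lemma l1_gt0 : 0 < l1. Proof. exact: lt_le_trans lk_gt0 lk_le_l1. Qed.

Local Lemma Sigma_sym : Sigma^T = Sigma.
Proof. by case: halfP => hs _ <-; rewrite trmx_mul hs. Qed.

Local Lemma Sigma_psd v : 0 <= dot v (Sigma *m v).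
Proof. by rewrite -(dot_half halfP) dot_ge0. Qed.

Local Lemma Sigma_le v : vnorm v <= 2 -> dot v (Sigma *m v) <= 4 * l1.
Proof.
move=> v2; rewrite (le_trans (dot_le_eigval1 _ Sigma_sym lamP))// mulrC.
rewrite ler_pM2r ?l1_gt0// -sqr_vnorm (_ : 4 = 2 ^+ 2) ?ler_sqr ?nnegrE ?vnorm_ge0//.
by rewrite expr2 -natrM.
Qed.

Local Lemma sample_cov_sym w :
  (sample_cov (fun i => X i w))^T = sample_cov (fun i => X i w).
Proof.
rewrite /sample_cov linearZ/= raddf_sum/=; congr (_ *: _).
by apply: eq_bigr => i _; rewrite trmx_mul trmxK.
Qed.

Let dev w v := dot v ((sample_cov (fun i => X i w) - Sigma) *m v).

(** The union bound over a finite family of test vectors, with the common tail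
    bound written as a power of [p]. *)
Lemma family_deviation (I : finType) (v : I -> 'cV[R]_p) t j : 0 < t <= 1 ->
  (forall i, vnorm (v i) <= 2) ->
  n%:R * t ^+ 2 / (4 * bernstein_const R) = j%:R * ln p%:R ->
  exists N, [/\ measurable N,
    (P N <= (#|I|%:R * (2 * p%:R^-1 ^+ j))%:E)%E &
    forall w, ~ N w -> forall i, `|dev w (v i)| <= 64 * K ^+ 2 * (4 * l1) * t].
Proof.
move=> /andP[t0 t1] v2 tE.
have l40 : 0 < 4 * l1 by rewrite mulr_gt0// l1_gt0.
pose bad i := [set w | 64 * K ^+ 2 * (4 * l1) * t <= `|dev w (v i)|].
have mbad i : measurable (bad i).
  have mf := measurable_dot_sample_cov halfP XE (v i) n0.
  have mn : measurable_fun setT (fun w => `|dev w (v i)| : R) by exact: measurableT_comp.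
  have := mn measurableT _ (measurable_itv `[64 * K ^+ 2 * (4 * l1) * t, +oo[).
  by rewrite setTI set_itvE.
have Pbad i : (P (bad i) <= (2 * p%:R^-1 ^+ j)%:E)%E.
  have t01 : 0 <= t <= 1 by rewrite ltW.
  rewrite (le_trans (quad_form_deviation halfP XE X_mean X_cov Y_vec Y_coord Y_law
    n0 l40 (Sigma_le (v2 i)) t01))// (expRN_ln (y := p%:R) _ tE)//.
  by rewrite ltr0n (leq_trans _ p64).
have [N [mN AN PN]] := finite_union_bound mbad Pbad.
exists N; split => // w Nw i; rewrite leNgt; apply/negP => h.
by apply: Nw; apply: (AN i); rewrite /bad/= ltW.
Qed.

(* The levels [t1] for the grid and [t2] for the probes make the Gaussian
   tails equal to [p^(-10 s)] and [p^(-10)]. *)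
Let x : R := s%:R * ln p%:R / n%:R.
Let y : R := ln p%:R / n%:R.
Let t1 := Num.sqrt (A * x).
Let t2 := Num.sqrt (A * y).
Let tau (t : R) : R := 64 * K ^+ 2 * (4 * l1) * t.

Local Lemma y_gt0 : 0 < y.
Proof. by rewrite divr_gt0 ?ltr0n// ln_gt0// ltr1n (leq_trans _ p64). Qed.

Local Lemma y_le_x : y <= x.
Proof.
rewrite /x -mulrA -/y -[leLHS]mul1r ler_pM2r ?y_gt0//.
by rewrite ler1n.
Qed.

Local Lemma x_gt0 : 0 < x. Proof. exact: lt_le_trans y_gt0 y_le_x. Qed.

Lemma good_event : exists N, [/\ measurable N, (P N <= (p%:R ^- 2)%:E)%E &
  forall w, ~ N w ->
  (forall z, vnorm (grid_point R (N := p) z) <= 2 ->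
    `|dev w (emb_mx R J *m grid_point R (N := p) z)| <= tau t1) /\
  (forall i j (b : bool), `|dev w (emb_mx R J *m
     (probe_vector Sigma lam U i j + (-1) ^+ b *: col j ((emb_mx R J)^T *m U)))| <= tau t2)].
Proof.
have n0' : n%:R != 0 :> R by rewrite pnatr_eq0 -lt0n.
have M0 : bernstein_const R != 0.
  by rewrite gt_eqF// (lt_le_trans _ (bernstein_const_ge R)).
have Ax := mulr_gt0 A_gt0 x_gt0; have Ay := mulr_gt0 A_gt0 y_gt0.
have sqrt_01 z : 0 < z <= 1 -> 0 < Num.sqrt z <= 1.
  by move=> /andP[z0 z1]; rewrite sqrtr_gt0 z0 -sqrtr1 ler_wsqrtr.
have t1P : 0 < t1 <= 1 by apply: sqrt_01; rewrite Ax small.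
have t2P : 0 < t2 <= 1.
  by apply: sqrt_01; rewrite Ay (le_trans _ small)// ler_pM2l ?A_gt0// y_le_x.
have t1E : n%:R * t1 ^+ 2 / (4 * bernstein_const R) = (10 * s)%:R * ln p%:R.
  by rewrite sqr_sqrtr ?ltW// /x /A natrM; field; rewrite n0' M0.
have t2E : n%:R * t2 ^+ 2 / (4 * bernstein_const R) = 10%:R * ln p%:R.
  by rewrite sqr_sqrtr ?ltW// /y /A; field; rewrite n0' M0.
(* Grid points outside the ball of radius 2 are replaced by 0, which keeps the
   variance proxy of the whole family below [4 * l1]. *)
pose v1 (z : {ffun 'I_#|J| -> 'I_p.*2.+1}) : 'cV[R]_p :=
  if vnorm (grid_point R z) <= 2 then emb_mx R J *m grid_point R z else 0.
have v1P z : vnorm (v1 z) <= 2.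
  rewrite /v1; case: ifP => [|_]; last by rewrite vnorm0.
  by rewrite (vnorm_isometry _ (emb_mx_isometry R J)).
pose v2 (i : 'I_#|J| * 'I_k * bool) : 'cV[R]_p := emb_mx R J *m
  (probe_vector Sigma lam U i.1.1 i.1.2 +
   (-1) ^+ i.2 *: col i.1.2 ((emb_mx R J)^T *m U)).
have v2P i : vnorm (v2 i) <= 2.
  rewrite (vnorm_isometry _ (emb_mx_isometry R J)) (le_trans (vnormD _ _))//.
  rewrite (vnormZ ((-1) ^+ i.2)) normr_sign mul1r (_ : 2 = 1 + 1)// lerD//.
    exact: (vnorm_probe_vector Sigma_sym Sigma_psd lamP lam0 gap eU UJ0).
  by rewrite (vnorm_col_isometry _ (restrict_U_isometry eU UJ0)).
have [N1 [mN1 PN1 hN1]] := family_deviation t1P v1P t1E.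
have [N2 [mN2 PN2 hN2]] := family_deviation t2P v2P t2E.
exists (N1 `|` N2); split; first exact: measurableU.
  apply: (le_trans (measureU2 _ mN1 mN2)).
  rewrite (_ : p%:R ^- 2 = p%:R ^- 2 / 2 + p%:R ^- 2 / 2); last by rewrite -splitr.
  have km : (k <= #|J|)%N := isometry_leq (restrict_U_isometry eU UJ0).
  have Jp : (#|J| <= p)%N by rewrite -[p in (_ <= p)%N]card_ord max_card.
  rewrite EFinD leeD//.
    rewrite (le_trans PN1)// lee_fin card_ffun !card_ord.
    exact: grid_tail_small.
  rewrite (le_trans PN2)// lee_fin !card_prod !card_ord card_bool.
  by apply: probe_tail_small => //; exact: leq_trans Jp.
move=> w /not_orP[w1 w2]; split => [z z2|i j b].
  by have := hN1 w w1 z; rewrite /v1 z2.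
exact: (hN2 w w2 (i, j, b)).
Qed.

(** The first-order term contributes the second summand of [error5] and the
    quadratic remainder the first one.  If the perturbation is not small compared
    with the gap, [error5] is bounded below by a constant. *)
Lemma refit_rate_deterministic w :
  Jhat w = J ->
  (forall z, vnorm (grid_point R (N := p) z) <= 2 ->
    `|dev w (emb_mx R J *m grid_point R (N := p) z)| <= tau t1) ->
  (forall i j (b : bool), `|dev w (emb_mx R J *m
     (probe_vector Sigma lam U i j + (-1) ^+ b *: col j ((emb_mx R J)^T *m U)))| <= tau t2) ->
  exists2 W : 'M[R]_k, orthogonal_mx W &
    norm2inf (Ut w - U *m W) <= refit_const B * error5 n p s k lam.
Proof.
move=> wJ h1 h2.
have km : (k <= #|J|)%N := isometry_leq (restrict_U_isometry eU UJ0).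
have Jp : (#|J| <= p)%N by rewrite -[p in (_ <= p)%N]card_ord max_card.
have ref : refit_output (sample_cov (fun i => X i w)) J (Ut w).
  by have := @refit w; rewrite wJ; exact.
have g0 : 0 < lk - mu by rewrite subr_gt0.
pose g := lk - mu; pose kap := l1 / lk; pose r := l1 / g.
have r0 : 0 < r by rewrite divr_gt0// l1_gt0.
have kap0 : 0 < kap by rewrite divr_gt0 ?l1_gt0 ?lk_gt0.
have K2 : 0 <= K ^+ 2 by exact: sqr_ge0.
have rkap : r <= 2 * kap.
  rewrite /r /kap ler_pdivrMr// (_ : 2 * (l1 / lk) * g = l1 * (2 * g / lk)); last first.
    by field; rewrite gt_eqF// lk_gt0.
  rewrite ler_peMr ?(ltW l1_gt0)// ler_pdivlMr ?lk_gt0// mul1r /g.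
  by move: half_gap; rewrite -/lk -/mu; lra.
have e5E : error5 n p s k lam = kap * r * x + kap * Num.sqrt (k%:R * y).
  by rewrite /error5 /kap /r /x /y /g !mulrA.
have S0 : 0 <= Num.sqrt (k%:R * y) by exact: sqrtr_ge0.
have A0 := A_gt0; have x0 := x_gt0; have y0 := y_gt0.
pose D1 := 256 * K ^+ 2 * Num.sqrt A.
pose D2 := 36 * (512 * K ^+ 2) ^+ 2 * A.
have D10 : 0 <= D1 := mulr_ge0 (mulr_ge0 (ler0n _ _) K2) (sqrtr_ge0 _).
have D20 : 0 <= D2 := mulr_ge0 (mulr_ge0 (ler0n _ _) (sqr_ge0 _)) (ltW A0).
have cE : refit_const B = D1 + 8 * D2 by [].
have kS0 : 0 <= kap * Num.sqrt (k%:R * y) by rewrite mulr_ge0 ?(ltW kap0).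
have krx0 : 0 <= kap * r * x := mulr_ge0 (mulr_ge0 (ltW kap0) (ltW r0)) (ltW x0).
have eta2 : 18 * (2 * tau t1 / g) ^+ 2 <= D2 * (kap * r * x).
  have gen (Q a : R) : 0 <= Q -> 0 <= a ->
      18 * (Q * r ^+ 2 * (a * x)) <= 36 * Q * a * (kap * r * x).
    move=> Q0 a0; have := mulr_ge0 (mulr_ge0 (mulr_ge0 Q0 a0) (ltW x0)) (ltW r0).
    by move=> /ler_wpM2l/(_ _ _ rkap); lra.
  have -> : 2 * tau t1 / g = 512 * K ^+ 2 * r * t1 by rewrite /tau /r; ring.
  rewrite 2!exprMn sqr_sqrtr; last exact: mulr_ge0 (ltW A0) (ltW x0).
  exact: gen (sqr_ge0 _) (ltW A0).
have D2e : D2 * (kap * r * x) <= refit_const B * error5 n p s k lam / 8.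
  rewrite cE e5E; have := mulr_ge0 D10 krx0; have := mulr_ge0 D10 kS0.
  by have := mulr_ge0 D20 kS0; have := mulr_ge0 D20 krx0; lra.
have [sm|big] := leP (2 * tau t1) (g / 8); last first.
  have [W WW HW] := refit_trivial_bound eU ref.
  exists W => //; apply: (le_trans HW).
  have : 8^-1 < 2 * tau t1 / g by rewrite ltr_pdivlMr// mulrC.
  move=> h; have : 8^-1 ^+ 2 < (2 * tau t1 / g) ^+ 2.
    by rewrite ltr_sqr ?nnegrE ?invr_ge0// (le_trans _ (ltW h)).
  move: eta2 D2e; lra.
have tau0 t : 0 <= t -> 0 <= tau t.
  exact: mulr_ge0 (mulr_ge0 (mulr_ge0 (ler0n _ _) K2) (mulr_ge0 (ler0n _ _) (ltW l1_gt0))).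
have Jp2 : (64 * #|J| <= p ^ 2)%N by rewrite -mulnn leq_mul.
have p0 : (0 < p)%N by rewrite (leq_trans _ p64).
have [W WW HW] := refit_row_bound k0 Sigma_sym Sigma_psd lamP lam0 gap eU UJ0
  (sample_cov_sym w) ref Jp2 p0 (tau0 _ (sqrtr_ge0 _)) (tau0 _ (sqrtr_ge0 _)) h1 h2 sm.
exists W => //; apply: (le_trans HW); rewrite -/lk -/mu -/g.
have first : Num.sqrt k%:R * (tau t2 / (2 * g)) <= D1 * (kap * Num.sqrt (k%:R * y)).
  rewrite sqrtrM ?ler0n// /t2 sqrtrM ?(ltW A0)//.
  rewrite (_ : Num.sqrt k%:R * _ =
    128 * K ^+ 2 * Num.sqrt A * Num.sqrt k%:R * Num.sqrt y * r); last first.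
    by rewrite /tau /r; field; rewrite gt_eqF.
  rewrite (_ : D1 * _ =
    128 * K ^+ 2 * Num.sqrt A * Num.sqrt k%:R * Num.sqrt y * (2 * kap)); last first.
    by rewrite /D1; ring.
  exact: ler_wpM2l (mulr_ge0 (mulr_ge0 (mulr_ge0 (mulr_ge0 (ler0n _ _) K2)
    (sqrtr_ge0 _)) (sqrtr_ge0 _)) (sqrtr_ge0 _)) _ _ rkap.
apply: (le_trans (lerD first eta2)); rewrite cE e5E.
have := mulr_ge0 D10 krx0; have := mulr_ge0 D20 kS0; have := mulr_ge0 D20 krx0.
lra.
Qed.

(** The non-asymptotic form of the result. *)
Theorem refit_rate : prob_at_least P (1 - delta - p%:R ^- 2)
  [set w | exists2 W : 'M[R]_k, orthogonal_mx W &
    norm2inf (Ut w - U *m W) <= refit_const B * error5 n p s k lam].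
Proof.
have [N [mN PN hN]] := good_event.
exists ([set w | Jhat w = J] `\` N); split.
- exact: measurableD.
- by move=> w [wJ /hN[h1 h2]]; exact: refit_rate_deterministic.
- exact: measure_setD_ge.
Qed.

End refit_rate.

Lemma refit_const_ge0 (R : realType) (B : R) : 0 <= refit_const B.
Proof.
have M0 : 0 <= bernstein_const R := le_trans (ler0n _ _) (bernstein_const_ge R).
apply: addr_ge0.
  exact: mulr_ge0 (mulr_ge0 (ler0n _ _) (sqr_ge0 _)) (sqrtr_ge0 _).
apply: mulr_ge0 => //; apply: mulr_ge0; last exact: mulr_ge0.
exact: mulr_ge0 (ler0n _ _) (sqr_ge0 _).
Qed.

Lemma error5_le_sum (R : realType) (n p s k : nat) (Sigma : 'M[R]_p)
    (lam : seq R) (U : 'M[R]_(p, k)) : (0 < p)%N ->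
  0 <= eigval lam 1 -> 0 <= eigval lam k.+1 < eigval lam k ->
  error5 n p s k lam <= error1 n s lam U + error2 n s lam U
    + error3 n s Sigma lam U + error4 n p s k lam + error5 n p s k lam.
Proof.
move=> p0 l10 /andP[mu0 ml]; rewrite lerDr.
have lk0 : 0 <= eigval lam k by rewrite (le_trans mu0)// ltW.
have g0 : 0 <= eigval lam k - eigval lam k.+1 by rewrite subr_ge0 ltW.
have U0 := norm2inf_ge0 U.
have lp : 0 <= ln p%:R :> R by rewrite ln_ge0// ler1n.
have min0 : 0 <= Num.min (Num.sqrt (mx_norm Sigma))
    (Num.sqrt (eigval lam 1) * norm2inf U).
  by rewrite le_min sqrtr_ge0 mulr_ge0// sqrtr_ge0.
rewrite /error1 /error2 /error3 /error4 /=.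
move: (eigval lam k - eigval lam k.+1) g0 (Num.min _ _) min0 => g g0 mn mn0.
by do ![exact: ler0n|exact: sqrtr_ge0|assumption|apply: addr_ge0|
  apply: mulr_ge0|rewrite invr_ge0|apply: exprn_ge0].
Qed.

Theorem theorem2 (R : realType) (B : R) :
  exists C0 : R, forall C : R, C0 <= C ->
  forall (eps : R) (p s k : nat -> nat) (delta : nat -> R)
    (d : nat -> measure_display) (Omega : forall n, measurableType (d n))
    (P : forall n, probability (Omega n) R)
    (Sigma Sigma_half : forall n, 'M[R]_(p n)) (lam : nat -> seq R)
    (U : forall n, 'M[R]_(p n, k n)) (J : forall n, {set 'I_(p n)})
    (X : forall n, 'I_n -> Omega n -> 'cV[R]_(p n))
    (Y : forall n, 'I_n -> 'I_(p n) -> {RV (P n) >-> R})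
    (alg : forall n, Omega n -> 'M[R]_(p n) -> {set 'I_(p n)})
    (Jhat : forall n, Omega n -> {set 'I_(p n)})
    (Utilde : forall n, Omega n -> 'M[R]_(p n, k n)),
  (* setting *)
  (forall n, (0 < n)%N ->
    [/\ (0 < p n)%N, (0 < s n)%N & (0 < k n)%N]) ->
  (forall n, (0 < n)%N ->
    (forall i j, ('E_(P n)[(fun w => X n i w j 0%R)] = 0)%E) /\
    (forall i a b,
      covariance (P n) (fun w => X n i w a 0) (fun w => X n i w b 0)
      = (Sigma n a b)%:E)) ->
  (forall n, (0 < n)%N ->
    [/\ is_spectrum (Sigma n) (lam n), {in lam n, forall x, 0 <= x}
      & eigval (lam n) (k n).+1 < eigval (lam n) (k n)]) ->
  (forall n, (0 < n)%N -> eigenvectors_for (Sigma n) (lam n) (U n)) ->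
  (forall n, (0 < n)%N ->
    (#|J n| <= s n)%N /\ (forall i, i \notin J n -> row i (U n) = 0)) ->
  (* procedure *)
  (forall n, (0 < n)%N -> forall w,
    Jhat n w = alg n w (sample_cov (fun i => X n i w))) ->
  (forall n, (0 < n)%N -> forall K, measurable [set w | Jhat n w = K]) ->
  (forall n, (0 < n)%N -> forall w, (k n <= #|Jhat n w|)%N ->
    refit_output (sample_cov (fun i => X n i w)) (Jhat n w) (Utilde n w)) ->
  (* (1) *)
  asymp_ll (fun n => (s n)%:R * ln (p n)%:R) (fun n => n%:R : R) ->
  asymp_ll (fun n => (k n)%:R) (fun n => (s n)%:R : R) ->
  asymp_le (fun n => n%:R) (fun n => (p n)%:R : R) ->
  (* (2) *)
  (\forall n \near \oo,
    ((1 - delta n)%:E <= P n [set w | Jhat n w = J n])%E) ->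
  (* (3) *)
  (forall n, (0 < n)%N ->
    is_psd_sqrt (Sigma n) (Sigma_half n) /\
    (forall i w, X n i w = Sigma_half n *m \col_j Y n i j w)) ->
  (forall n, (0 < n)%N ->
    independent_vectors (P n) (fun i j => Y n i j : Omega n -> R) /\
    (forall i, independent_RVs (P n) (fun j => Y n i j : Omega n -> R))) ->
  (forall n, (0 < n)%N -> forall i j,
    [/\ ('E_(P n)[Y n i j] = 0)%E, ('V_(P n)[Y n i j] = 1)%E
      & (psi2_norm (P n) (Y n i j) <= B%:E)%E]) ->
  (* (4) *)
  (\forall n \near \oo,
    C * eigval (lam n) 1
      * (Num.sqrt ((s n)%:R / n%:R) + Num.sqrt (ln (p n)%:R / n%:R))
    + eigval (lam n) (k n).+1 / 8 <= eigval (lam n) (k n) / 8) ->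
  64^-1 < eps ->
  (forall n, (0 < n)%N ->
    2 * eigval (lam n) (k n).+1 < (1 - eps) * eigval (lam n) (k n)) ->
  (* conclusion *)
  exists C' : R, \forall n \near \oo,
    prob_at_least (P n) (1 - delta n - (p n)%:R ^- 2)
      [set w | exists2 W : 'M[R]_(k n), orthogonal_mx W &
        norm2inf (Utilde n w - U n *m W) <=
        C' * (error1 n (s n) (lam n) (U n) + error2 n (s n) (lam n) (U n)
              + error3 n (s n) (Sigma n) (lam n) (U n)
              + error4 n (p n) (s n) (k n) (lam n)
              + error5 n (p n) (s n) (k n) (lam n))].
Proof.
exists 0 => C _ eps p s k delta d Omega P Sigma half lam U J X Y alg Jhat Ut.
move=> pos mom spec eig supp _ mJhat refit slogp _ np JhatP model indep law _ eps64 gap2.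
exists (refit_const B).
have A0 : 0 < 40 * bernstein_const R.
  by rewrite mulr_gt0// (lt_le_trans _ (bernstein_const_ge R)).
have Ai : 0 < (40 * bernstein_const R)^-1 by rewrite invr_gt0.
have small : \forall n \near \oo,
    `|(s n)%:R * ln (p n)%:R / n%:R| < (40 * bernstein_const R)^-1.
  by move/cvgr0Pnorm_lt : slogp; exact.
have [C1 np1] := np.
(* This growth of [n] together with [n <= C1 * p] forces [64 <= p]. *)
have large : \forall n \near \oo, `|C1| * 64 < n%:R :> R by exact: nbhs_infty_gtr.
near=> n.
have n0 : (0 < n)%N by near: n; exact: nbhs_infty_gt.
have [p0 s0 k0] := pos _ n0.
have p64 : (64 <= p n)%N.
  rewrite leqNgt; apply/negP => p64.
  have h1 : n%:R <= C1 * (p n)%:R by near: n.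
  have h2 : `|C1| * 64 < n%:R by near: n.
  have : C1 * (p n)%:R <= `|C1| * 64.
    rewrite (le_trans (ler_wpM2r (ler0n _ _) (ler_norm C1)))// ler_wpM2l//.
    by rewrite ler_nat ltnW.
  by rewrite leNgt => /negP; apply; exact: lt_le_trans h2 h1.
have sm : 40 * bernstein_const R * ((s n)%:R * ln (p n)%:R / n%:R) <= 1.
  have : `|(s n)%:R * ln (p n)%:R / n%:R| < (40 * bernstein_const R)^-1.
    by near: n.
  move=> /(le_lt_trans (ler_norm _))/ltW.
  by rewrite -(ler_pM2l A0) divff// gt_eqF.
have [lamP lam0 gap] := spec _ n0.
have [halfP XE] := model _ n0.
have [X_mean X_cov] := mom _ n0.
have [Y_vec Y_coord] := indep _ n0.
have [Js UJ] := supp _ n0.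
have mu0 := eigval_tail_ge0 (k n) lam0.
have half_gap : 2 * eigval (lam n) (k n).+1 <= eigval (lam n) (k n).
  rewrite (le_trans (ltW (gap2 _ n0)))// ler_piMl//.
    exact: le_trans mu0 (ltW gap).
  by move: eps64; lra.
have JP : ((1 - delta n)%:E <= P n [set w | Jhat n w = J n])%E by near: n.
have [E [mE Egood EP]] := refit_rate n0 s0 k0 halfP XE X_mean X_cov Y_vec Y_coord
  (law _ n0) lamP lam0 gap half_gap (eig _ n0) Js UJ (mJhat _ n0 (J n)) JP
  (refit _ n0) p64 sm.
exists E; split => // w /Egood[W WW HW]; exists W => //; apply: (le_trans HW).
rewrite ler_wpM2l ?refit_const_ge0//; apply: error5_le_sum => //.
  have [slam _] := lamP; apply: le_trans mu0 _.
  exact: eigval_nonincreasing.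
by rewrite mu0.
Unshelve. all: by end_near.
Qed.
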